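(* There is an absolute constant $C>0$ such that the following holds. Fix $j\in\mathbb N$ and write $\phi=\phi_j$, $\lambda=\lambda_j$. If $x\in(0,1]$ is such that $\phi'(x)$ exists, then $$\Big|x\phi'(x)+\lambda\phi(1)\widetilde B_1\!\left(\tfrac1x\right)\Big|\le C\,|\lambda|^5(\log|\lambda|)^2\Big(1+\log\tfrac1x\Big)x.$$
   Context: Let $K:[0,1]\times[0,1]\to\mathbb R$ be defined by $K(x,y)=\frac12-\{(xy)^{-1}\}$ if $0<x,y\le 1$, and $K(x,y)=0$ if $0\le x,y\le1$ and $xy=0$, where $\{\alpha\}=\alpha-\lfloor\alpha\rfloor$. Let $L^2([0,1])$ denote the space of real-valued Lebesgue measurable square-integrable functions on $[0,1]$, with $\langle f,g\rangle=\int_0^1 f(x)g(x)\,dx$ and $\|f\|=\langle f,f\rangle^{1/2}$. A function $\phi$ is an eigenfunction of $K$ (with eigenvalue $\lambda\in\mathbb R$) if $\phi\in L^2([0,1])$, $\|\phi\|>0$, and $\phi(x)=\lambda\int_0^1 K(x,y)\phi(y)\,dy$ for every $x\in[0,1]$. Let $\phi_1,\phi_2,\ldots$ be a maximal orthonormal system in $L^2([0,1])$ of eigenfunctions of $K$, $\phi_j$ having the nonzero real eigenvalue $\lambda_j$, numbered so that $0<|\lambda_1|\le|\lambda_2|\le\cdots$ and $\lambda_j\ge\lambda_{j+1}$ whenever $|\lambda_j|=|\lambda_{j+1}|$. The periodic Bernoulli function is $\widetilde B_1(t)=\{t\}-\frac12$ for $t\in\mathbb R$. *)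

(* Defs.v *)
From HB Require Import structures.
From mathcomp Require Import all_boot all_order all_algebra.
From mathcomp Require Import all_classical all_reals all_analysis.
Set Implicit Arguments. Unset Strict Implicit. Unset Printing Implicit Defensive.
Import Order.TTheory GRing.Theory Num.Theory.
Import numFieldNormedType.Exports.
Local Open Scope classical_set_scope.
Local Open Scope ring_scope.

Section Defs.
Variable R : realType.

Definition frac (a : R) : R := a - (Num.floor a)%:~R.

Definition B1 (t : R) : R := frac t - 2^-1.

(* K(x,y) = 1/2 - {(xy)^{-1}} if xy <> 0, and 0 if xy = 0
   (only its values on [0,1]^2 are ever used) *)
Definition Kern (x y : R) : R :=
  if x * y == 0 then 0 else 2^-1 - frac (x * y)^-1.

Definition I01 : set R := `[0, 1]%classic.

Definition mu := @lebesgue_measure R.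

Definition L2_01 (f : R -> R) : Prop :=
  measurable_fun I01 f /\ mu.-integrable I01 (fun x => ((f x) ^+ 2)%:E).

Definition inner (f g : R -> R) : R := Rintegral mu I01 (fun x => f x * g x).

Definition norm2 (f : R -> R) : R := Num.sqrt (inner f f).

Definition eigenfun (phi : R -> R) (lam : R) : Prop :=
  L2_01 phi /\ 0 < norm2 phi /\
  forall x, x \in I01 ->
    phi x = lam * Rintegral mu I01 (fun y => Kern x y * phi y).

Definition eigen_system (phi : nat -> R -> R) (lam : nat -> R) : Prop :=
  [/\ (forall j, lam j != 0 /\ eigenfun (phi j) (lam j)),
      (forall i j, inner (phi i) (phi j) = (i == j)%:R),
      (forall psi (m : R), m != 0 -> eigenfun psi m -> norm2 psi = 1 ->
          ~ (forall j, inner psi (phi j) = 0)),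
      (forall j, `|lam j| <= `|lam j.+1|) &
      (forall j, `|lam j| = `|lam j.+1| -> lam j.+1 <= lam j)].

(* f has derivative d at x, as a function on [0,1]
   (one-sided at the endpoints of [0,1]) *)
Definition deriv01 (f : R -> R) (x d : R) : Prop :=
  (fun h => (f (x + h) - f x) / h) @ within [set h | x + h \in I01] (0 : R)^'
    --> d.

End Defs.

(* Main.v *)
Require Import Defs.
From HB Require Import structures.
From mathcomp Require Import all_boot all_order all_algebra.
From mathcomp Require Import all_classical all_reals all_analysis.
From mathcomp Require Import measurable_realfun.
From mathcomp Require Import ring lra.
Import Order.TTheory GRing.Theory Num.Theory.
Import numFieldNormedType.Exports.
Local Open Scope classical_set_scope.
Local Open Scope ring_scope.
Set Implicit Arguments. Unset Strict Implicit. Unset Printing Implicit Defensive.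

(**
Write [k v = 1/2 - {1/v}], so that [phi x = lam * \int_0^1 k (x y) phi y dy], and
put [L = |lam|], [l = ln L].  Instead of differentiating, we work with the
multiplicative difference quotients [psi_s x = (phi x - phi (s x)) / (1 - s)],
[1/2 <= s < 1], which tend to [x * phi' x] as [s -> 1].  Because the kernel depends
on [x y] only, dilating the variable of integration gives the exact identity
  [psi_s x = - phi x / s - lam * \int_0^1 k (s x y) psi_s y dy
             + lam / (s (1 - s)) * \int_s^1 k (x u) phi u du],
whose last term tends to [lam * k x * phi 1 = - lam * phi 1 * B1 (1/x)].

The iterated kernel [k2 x y = \int_0^1 k (x z) k (y z) dz] is [O (min (1, x/y))],
since the primitive of [k] is [O (v^2)].  Applied to [phi = lam^2 * K2 phi] this
gives [phi x = O (L^3 x (1 + ln (1/x)))].  A direct estimate of [phi x - phi (s x)]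
then gives [psi_s x = O (L^2 l / x)]; the identity improves it to
[O (L^3 l (l + ln (1/x)))], and substituting the identity into itself, to
[O (L^3 l^2)] uniformly in [x] and [s].  A last substitution bounds the middle term
by [O (L^5 l^2 x (1 + ln (1/x)))], and [s -> 1] concludes.
*)

(** * Integrals over half-open intervals *)

Section Integrals.
Context {R : realType}.
Local Notation leb := (@lebesgue_measure R).
Implicit Types (a b c s M : R) (f g : R -> R).

(** Half-open intervals concatenate exactly, leave out the singular point 0, and match the level
    sets of [Num.floor z^-1] for [z > 0]. The value is 0 when [b <= a]. *)
Definition intoc a b f : R := Rintegral leb `]a, b]%classic f.
Definition itgoc a b f : Prop := leb.-integrable `]a, b]%classic (EFin \o f).

Lemma lebesgue_itvoc_fine a b : a <= b -> fine (leb `]a, b]%classic) = b - a.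
Proof.
rewrite le_eqVlt => /predU1P[->|ab].
  by rewrite lebesgue_measure_itv/= lte_fin ltxx/= subrr.
by rewrite lebesgue_measure_itv/= lte_fin ab -EFinB.
Qed.

Lemma itgoc_bounded a b M f : measurable_fun setT f ->
  (forall t, a < t <= b -> `|f t| <= M) -> itgoc a b f.
Proof.
move=> mf fM; apply: measurable_bounded_integrable => //=.
- by rewrite lebesgue_measure_itv/= ; case: ifP => _; rewrite ?ltry// -EFinB ltry.
- exact: measurable_funTS.
- exists M; split; first exact: num_real.
  move=> y My t /=; rewrite in_itv/= => tab.
  by apply: le_trans (fM _ tab) _; exact: ltW.
Qed.

Lemma itgoc_le a b f g : measurable_fun setT f ->
  (forall t, a < t <= b -> `|f t| <= g t) -> itgoc a b g -> itgoc a b f.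
Proof.
move=> mf fg; apply: le_integrable => //=.
  by apply/measurable_EFinP; exact: measurable_funTS.
move=> t /=; rewrite in_itv/= => tab; rewrite lee_fin.
by apply: le_trans (fg _ tab) _; exact: ler_norm.
Qed.

Lemma itgoc_sub a b c d f : c <= a -> b <= d -> itgoc c d f -> itgoc a b f.
Proof.
move=> ca bd; apply: integrableS => //.
by apply: subset_itv; rewrite bnd_simp.
Qed.

Lemma itgocD a b f g : itgoc a b f -> itgoc a b g -> itgoc a b (fun t => f t + g t).
Proof. by move=> If Ig; refine (integrableD _ If Ig). Qed.

Lemma itgocB a b f g : itgoc a b f -> itgoc a b g -> itgoc a b (fun t => f t - g t).
Proof. by move=> If Ig; refine (integrableB _ If Ig). Qed.

Lemma itgocZ a b M f : itgoc a b f -> itgoc a b (fun t => M * f t).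
Proof. by move=> If; refine (integrableZl _ M If). Qed.

Lemma intocD a b f g : itgoc a b f -> itgoc a b g ->
  intoc a b (fun t => f t + g t) = intoc a b f + intoc a b g.
Proof. by move=> ? ?; exact: RintegralD. Qed.

Lemma intocB a b f g : itgoc a b f -> itgoc a b g ->
  intoc a b (fun t => f t - g t) = intoc a b f - intoc a b g.
Proof. by move=> ? ?; exact: RintegralB. Qed.

Lemma intocZ a b M f : itgoc a b f -> intoc a b (fun t => M * f t) = M * intoc a b f.
Proof. by move=> ?; exact: RintegralZl. Qed.

Lemma eq_intoc a b f g : (forall t, a < t <= b -> f t = g t) ->
  intoc a b f = intoc a b g.
Proof. by move=> fg; apply: eq_Rintegral => t; rewrite inE/= in_itv/= => /fg. Qed.

Lemma intoc_ge0 a b f : (forall t, a < t <= b -> 0 <= f t) -> 0 <= intoc a b f.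
Proof. by move=> f0; apply: Rintegral_ge0 => t /=; rewrite in_itv/= => /f0. Qed.

Lemma intoc_cst a b M : a <= b -> intoc a b (fun=> M) = M * (b - a).
Proof. by move=> ab; rewrite /intoc Rintegral_cst// lebesgue_itvoc_fine. Qed.

Lemma itgoc_cst a b M : itgoc a b (fun=> M).
Proof. by apply: (@itgoc_bounded _ _ `|M|). Qed.

Lemma le_intoc a b f g : itgoc a b f -> itgoc a b g ->
  (forall t, a < t <= b -> f t <= g t) -> intoc a b f <= intoc a b g.
Proof.
by move=> If Ig fg; apply: le_Rintegral => // t; rewrite /= in_itv/= => /fg.
Qed.

Lemma intoc_norm_le_itg a b f g : itgoc a b f -> itgoc a b g ->
  (forall t, a < t <= b -> `|f t| <= g t) -> `|intoc a b f| <= intoc a b g.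
Proof.
move=> If Ig fg; apply: le_trans (le_normr_Rintegral _ If) _ => //.
by apply: le_intoc => //; exact: integrable_norm.
Qed.

Lemma intoc_norm_le a b f g : measurable_fun setT f -> itgoc a b g ->
  (forall t, a < t <= b -> `|f t| <= g t) -> `|intoc a b f| <= intoc a b g.
Proof.
by move=> mf Ig fg; apply: intoc_norm_le_itg => //; exact: itgoc_le fg Ig.
Qed.

Lemma intoc_norm_bnd a b M f : measurable_fun setT f -> a <= b ->
  (forall t, a < t <= b -> `|f t| <= M) -> `|intoc a b f| <= M * (b - a).
Proof.
by move=> mf ab fM; rewrite -intoc_cst//; apply: intoc_norm_le => //; exact: itgoc_cst.
Qed.

Lemma intoc_split a c b f : a <= c -> c <= b -> itgoc a b f ->
  intoc a b f = intoc a c f + intoc c b f.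
Proof.
move=> ac cb If; rewrite /intoc (@itv_bndbnd_setU _ _ _ (BRight c)) ?bnd_simp//.
rewrite Rintegral_setU//=.
  by rewrite -itv_bndbnd_setU// bnd_simp.
apply/disj_setPS => y [/=]; rewrite 2!in_itv/= => /andP[_ yx] /andP[].
by rewrite ltNge yx.
Qed.

(** This serves integrands cut off to a subinterval. If the two intervals are disjoint, the
    right-hand side runs over an empty interval and vanishes. *)
Lemma intoc_restrict a b p q f g :
  (forall t, a < t <= b -> p < t <= q -> g t = f t) ->
  (forall t, a < t <= b -> ~~ (p < t <= q) -> g t = 0) ->
  intoc a b g = intoc (Num.max a p) (Num.min b q) f.
Proof.
move=> gf g0; rewrite /intoc.
have -> : `]Num.max a p, Num.min b q]%classic = `]a, b]%classic `&` `]p, q]%classic.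
  apply/seteqP; split => t /=; rewrite !in_itv/= gt_max le_min.
    by move=> /andP[/andP[-> ->] /andP[-> ->]].
  by move=> [/andP[-> ->] /andP[-> ->]].
rewrite Rintegral_mkcondr; apply: eq_Rintegral => t; rewrite inE/= in_itv/= => tab.
rewrite /patch mem_setE; case: ifP => /= tpq; first exact: gf.
by apply: g0 => //; move/negbT: tpq.
Qed.

Lemma intocxx a f : intoc a a f = 0.
Proof. by rewrite /intoc set_itv_ge ?bnd_simp ?ltxx// Rintegral_set0. Qed.

Lemma intoc_closed a b f : itgoc a b f -> Rintegral leb `[a, b]%classic f = intoc a b f.
Proof. by move=> If; rewrite /intoc Rintegral_itv_obnd_cbnd. Qed.

End Integrals.

(** * Change of variables under dilations *)

Section Scaling.
Context {R : realType}.
Local Notation leb := (@lebesgue_measure R).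
Implicit Types (a b c s M : R) (f g : R -> R).

Lemma preimage_scale_itvoc s a b : 0 < s ->
  (fun x : R => s * x) @^-1` `]s * a, s * b]%classic = `]a, b]%classic.
Proof.
move=> s0; apply/seteqP; split=> x /=; rewrite !in_itv/=;
by rewrite ltr_pM2l// ler_pM2l.
Qed.

(** Lebesgue measure is [s] times its pushforward under [x -> s * x]: the two agree on half-open
    intervals, which determine the measure. The formula is then integration against a
    pushforward. *)
Lemma ge0_integral_scale s a b (f : R -> \bar R) : 0 < s ->
  measurable_fun setT f -> (forall x, 0 <= f x)%E ->
  (\int[leb]_(x in `](s * a)%R, (s * b)%R]) f x =
   s%:E * \int[leb]_(x in `]a, b]) f (s * x)%R)%E.
Proof.
move=> s0 mf f0.
have mg : measurable_fun setT (fun x : measurableTypeR R => s * x : measurableTypeR R).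
  exact: measurable_funM.
pose g : {mfun measurableTypeR R >-> measurableTypeR R} :=
  HB.pack (fun x : measurableTypeR R => s * x : measurableTypeR R)
    (isMeasurableFun.Build _ _ _ _ _ mg).
have sN : 0 <= s by exact: ltW.
pose k : {nonneg R} := NngNum sN.
have E A : measurable A -> leb A = mscale k (pushforward leb g) A.
  apply: lebesgue_measure_unique => _ [[u v] _ <-] /=.
  rewrite /mscale/= /pushforward.
  have -> : `]u, v]%classic = `]s * (u / s), s * (v / s)]%classic.
    by rewrite ![s * (_ / s)]mulrC !divfK ?gt_eqF.
  rewrite preimage_scale_itvoc// !lebesgue_measure_itv/= !lte_fin ltr_pM2l//.
  by case: ifP => _; rewrite ?mule0// -!EFinB -EFinM; congr EFin; ring.
rewrite (eq_measure_integral (mscale k (pushforward leb g))); last first.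
  by move=> A mA _; exact: E.
rewrite ge0_integral_mscale//; last exact: measurable_funTS.
congr (_ * _)%E; rewrite ge0_integral_pushforward//.
- by rewrite preimage_scale_itvoc.
- exact: measurable_funTS.
Qed.

Lemma itgoc_scale s a b f : 0 < s -> measurable_fun setT f ->
  itgoc (s * a) (s * b) f -> itgoc a b (fun t => f (s * t)).
Proof.
move=> s0 mf /integrableP[_ fi]; apply/integrableP; split.
  apply/measurable_EFinP/measurable_funTS.
  by apply: (measurableT_comp mf); exact: measurable_funM.
move: fi => /=; rewrite (@ge0_integral_scale s a b (fun x => `|(f x)%:E|%E))//; last first.
  apply: measurableT_comp => //; exact/measurable_EFinP.
rewrite ltey => fi; rewrite ltey; apply: contraNneq fi => /= ->.
by rewrite gt0_muley ?lte_fin.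
Qed.

(** The nonnegative case is applied to the positive and negative parts. Recombining them in the
    extended reals needs one of them finite, which [itgoc_scale] provides. *)
Lemma intoc_scale s a b f : 0 < s -> measurable_fun setT f ->
  itgoc (s * a) (s * b) f ->
  intoc a b (fun t => f (s * t)) = s^-1 * intoc (s * a) (s * b) f.
Proof.
move=> s0 mf If; have If' := itgoc_scale s0 mf If.
have mF : measurable_fun setT (EFin \o f) by exact/measurable_EFinP.
rewrite /intoc /Rintegral.
have -> : (\int[leb]_(x in `](s * a)%R, (s * b)%R]) (f x)%:E =
   s%:E * \int[leb]_(x in `]a, b]) (f (s * x))%:E)%E.
  pose h := EFin \o (fun t => f (s * t)).
  rewrite -[X in (_ * X)%E]/(\int[leb]_(x in `]a, b]) h x)%E integralE [in RHS]integralE.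
  rewrite !ge0_integral_scale//; last 2 first.
  - exact: measurable_funeneg.
  - exact: measurable_funepos.
  have -> : (\int[leb]_(x in `]a, b]) (EFin \o f)^\- (s * x)%R =
             \int[leb]_(x in `]a, b]) h^\- x)%E.
    by apply: eq_integral => x _; rewrite !funenegE.
  have -> : (\int[leb]_(x in `]a, b]) (EFin \o f)^\+ (s * x)%R =
             \int[leb]_(x in `]a, b]) h^\+ x)%E.
    by apply: eq_integral => x _; rewrite !funeposE.
  rewrite -muleBr//; apply: fin_num_adde_defl; rewrite fin_numN.
  by refine (integrable_neg_fin_num _ If').
have fi : (\int[leb]_(x in `]a, b]) (f (s * x))%:E \is a fin_num)%E.
  by refine (integrable_fin_num _ If').
by rewrite fineM//= mulKf// gt_eqF.
Qed.

End Scaling.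

(** * Fubini for bounded functions on a rectangle *)

Section Fubini.
Context {R : realType}.
Local Notation leb := (@lebesgue_measure R).
Variables (a b c d M : R) (F : measurableTypeR R * measurableTypeR R -> R).
Hypothesis mF : measurable_fun setT F.
Hypothesis FM : forall x y, a < x <= b -> c < y <= d -> `|F (x, y)| <= M.

Let D : set (measurableTypeR R * measurableTypeR R) := `]a, b]%classic `*` `]c, d]%classic.
(** Extending [F] by zero off the rectangle reduces both iterated integrals to integrals over the
    whole plane. *)
Let G : measurableTypeR R * measurableTypeR R -> \bar R := (EFin \o F) \_ D.

Let mG : measurable_fun setT G.
Proof.
apply/(measurable_restrictT _ _).1; first exact: measurableX.
by apply: measurable_funTS; exact/measurable_EFinP.
Qed.

Let iG : (leb \x leb)%E.-integrable setT G.
Proof.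
have mD : measurable D by exact: measurableX.
apply/(integrable_mkcond _ mD).
apply: measurable_bounded_integrable => //.
- change ((leb \x leb)%E D < +oo)%E.
  have -> : (leb \x leb)%E D = (leb `]a, b] * leb `]c, d])%E.
    exact: product_measure1E.
  rewrite !lebesgue_measure_itv/=.
  by case: ifP => _; case: ifP => _; rewrite ?mule0 ?mul0e ?ltry// -?EFinB -?EFinM ?ltry.
- exact: measurable_funTS.
- exists M; split; first exact: num_real.
  move=> y My [u v] /= []; rewrite /= !in_itv/= => uab vcd.
  by apply: le_trans (FM uab vcd) _; exact: ltW.
Qed.

Let itgoc2 x : a < x <= b -> itgoc c d (fun y => F (x, y)).
Proof.
move=> xab; apply: (@itgoc_bounded _ _ _ M); last by move=> y; exact: FM.
exact: measurableT_comp mF _.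
Qed.

Let itgoc1 y : c < y <= d -> itgoc a b (fun x => F (x, y)).
Proof.
move=> ycd; apply: (@itgoc_bounded _ _ _ M); last by move=> x /FM; apply.
exact: measurableT_comp mF _.
Qed.

Let inner2 x : (\int[leb]_y G (x, y) =
  ((fun x => (intoc c d (fun y => F (x, y)))%:E) \_ `]a, b]) x)%E.
Proof.
rewrite /patch mem_setE; case: ifP => xab.
  rewrite /intoc /Rintegral fineK; last by refine (integrable_fin_num _ (itgoc2 _)).
  rewrite [RHS]integral_mkcond; apply: eq_integral => y _.
  by rewrite /G /D /patch/= in_setX/= !mem_setE xab.
apply: integral0_eq => y _.
by rewrite /G /D /patch/= in_setX/= !mem_setE xab.
Qed.

Let inner1 y : (\int[leb]_x G (x, y) =
  ((fun y => (intoc a b (fun x => F (x, y)))%:E) \_ `]c, d]) y)%E.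
Proof.
rewrite /patch mem_setE; case: ifP => ycd.
  rewrite /intoc /Rintegral fineK; last by refine (integrable_fin_num _ (itgoc1 _)).
  rewrite [RHS]integral_mkcond; apply: eq_integral => x _.
  by rewrite /G /D /patch/= in_setX/= !mem_setE ycd andbT.
apply: integral0_eq => x _.
by rewrite /G /D /patch/= in_setX/= !mem_setE ycd andbF.
Qed.

Lemma intoc_fubini : intoc a b (fun x => intoc c d (fun y => F (x, y))) =
  intoc c d (fun y => intoc a b (fun x => F (x, y))).
Proof.
rewrite [LHS]/intoc [RHS]/intoc /Rintegral; congr fine.
rewrite integral_mkcond [RHS]integral_mkcond.
rewrite -(eq_integral _ _ (fun x _ => inner2 x)).
by rewrite -(eq_integral _ _ (fun x _ => inner1 x)) Fubini.
Qed.

Lemma itgoc_int : itgoc a b (fun x => intoc c d (fun y => F (x, y))).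
Proof.
apply/integrable_mkcond => //.
apply: eq_integrable (integrable_fubini_F iG) => // x _.
exact: inner2.
Qed.

End Fubini.

(** * Explicit integrals by the fundamental theorem of calculus *)

Section Primitives.
Context {R : realType}.
Local Notation leb := (@lebesgue_measure R).
Implicit Types (a b c s M : R) (f g : R -> R).

Lemma itgoc_continuous a b f :
  (forall x, a <= x <= b -> {for x, continuous f}) -> itgoc a b f.
Proof.
move=> cf; have : leb.-integrable `[a, b]%classic (EFin \o f).
  apply: continuous_compact_integrable; first exact: segment_compact.
  apply: continuous_in_subspaceT => x; rewrite inE/= in_itv/=; exact: cf.
by apply: integrableS => //; apply: subset_itv; rewrite bnd_simp.
Qed.

Lemma intoc_FTC a b f (F : R -> R) : a <= b ->
  (forall x, a <= x <= b -> {for x, continuous f}) ->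
  (forall x, a <= x <= b -> is_derive x 1 F (f x)) -> intoc a b f = F b - F a.
Proof.
rewrite le_eqVlt => /predU1P[->|ab cf dF]; first by rewrite intocxx subrr.
have cF x : a <= x <= b -> {for x, continuous F}.
  move=> /dF ?; apply: differentiable_continuous; exact/derivable1_diffP.
rewrite -intoc_closed; last exact: itgoc_continuous.
rewrite /Rintegral (@continuous_FTC2 _ f F)//.
- apply: continuous_in_subspaceT => x; rewrite inE/= in_itv/=; exact: cf.
- split.
  + move=> x; rewrite in_itv/= => /andP[ax xb].
    by apply: (@ex_derive _ _ _ _ _ _ _ (dF x _)); rewrite !ltW.
  + by apply: cvg_at_right_filter; apply: cF; rewrite lexx ltW.
  + by apply: cvg_at_left_filter; apply: cF; rewrite lexx ltW.
- move=> x; rewrite in_itv/= => /andP[ax xb]; rewrite derive1E.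
  by apply: (@derive_val _ _ _ _ _ _ _ (dF x _)); rewrite !ltW.
Qed.

Lemma intoc_affine a b p q : a <= b ->
  intoc a b (fun z => p + q * z) = p * (b - a) + q * (b ^+ 2 - a ^+ 2) / 2.
Proof.
move=> ab; apply: etrans; [apply: (@intoc_FTC _ _ _ (fun z => p * z + q / 2 * z ^+ 2)) => //|by rewrite /=; field].
- by move=> x _; apply: continuousD; [exact: cvg_cst|apply: continuousM; [exact: cvg_cst|]].
- move=> x _; apply: is_derive_eq.
  rewrite /GRing.scale/=; by field.
Qed.

Lemma inv_continuous_pos (x : R) : 0 < x -> {for x, continuous (@GRing.inv R)}.
Proof. by move=> x0; apply: continuousV => //; rewrite gt_eqF. Qed.

Lemma itgoc_inv a b : 0 < a -> itgoc a b (fun z => z^-1).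
Proof.
move=> a0; apply: itgoc_continuous => t /andP[at' _]; apply: inv_continuous_pos.
exact: lt_le_trans at'.
Qed.

Lemma intoc_inv a b : 0 < a -> a <= b -> intoc a b (fun z => z^-1) = ln b - ln a.
Proof.
move=> a0 ab; apply: intoc_FTC => // x /andP[ax xb].
- by apply: inv_continuous_pos; exact: lt_le_trans ax.
- by apply: is_derive1_ln; exact: lt_le_trans ax.
Qed.

Lemma intoc_invsq a b : 0 < a -> a <= b ->
  intoc a b (fun z => (z ^+ 2)^-1) = a^-1 - b^-1.
Proof.
move=> a0 ab; apply: etrans; [apply: (@intoc_FTC _ _ _ (fun z => - z^-1)) => //|by rewrite /=; ring].
- move=> x /andP[ax xb]; have x0 : 0 < x by exact: lt_le_trans ax.
  apply: continuousV; first by rewrite gt_eqF// exprn_gt0.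
  exact: exprn_continuous.
- move=> x /andP[ax xb]; have x0 : 0 < x by exact: lt_le_trans ax.
  have xn0 : x != 0 by rewrite gt_eqF.
  have dV : is_derive x 1 (fun z : R => z^-1) (- x ^- 2).
    apply: DeriveDef; first exact: derivableV.
    by rewrite deriveV// derive_id /GRing.scale/= mulr1.
  by have := is_deriveN dV; rewrite opprK.
Qed.

Lemma intoc_isqrt_pos a b : 0 < a -> a <= b ->
  intoc a b (fun z => (Num.sqrt z)^-1) = 2 * Num.sqrt b - 2 * Num.sqrt a.
Proof.
move=> a0 ab; apply: (@intoc_FTC _ _ _ (fun z => 2 * Num.sqrt z)) => //.
- move=> x /andP[ax xb]; have x0 : 0 < x by exact: lt_le_trans ax.
  apply: continuousV; first by rewrite gt_eqF// sqrtr_gt0.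
  exact: sqrt_continuous.
- move=> x /andP[ax xb]; have x0 : 0 < x by exact: lt_le_trans ax.
  have ? := is_derive1_sqrt x0.
  apply: is_derive_eq.
  by rewrite /GRing.scale/= invfM mulrA divff// mul1r.
Qed.

End Primitives.

(** * The kernel and its primitive *)

Section Kernel.
Context {R : realType}.
Local Notation leb := (@lebesgue_measure R).
Implicit Types (a b c s M : R) (f g : R -> R).

(** Monotone convergence along the intervals from [1 / (n + 1)] to [b], which increase to []0, b]].
    It is meant for integrands unbounded at 0, such as the inverse square root. *)
Lemma ge0_itgoc_lim b M f : measurable_fun setT f ->
  (forall t, 0 < t <= b -> 0 <= f t) ->
  (forall e, 0 < e -> itgoc e b f /\ intoc e b f <= M) ->
  itgoc 0 b f /\ intoc 0 b f <= M.
Proof.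
move=> mf f0 H.
pose F n := `]n.+1%:R^-1 : R, b]%classic.
have ndF : nondecreasing_seq F.
  apply/nondecreasing_seqP => n; rewrite /F subsetEset; apply: subset_itvr.
  by rewrite bnd_simp lef_pV2 ?posrE// ler_nat.
have UF : \bigcup_n F n = `]0, b]%classic.
  apply/seteqP; split => [x [n _]|x] /=; rewrite /F /= !in_itv/=.
    by move=> /andP[nx ->]; rewrite andbT; apply: lt_trans nx; rewrite invr_gt0.
  move=> /andP[x0 xb]; have [n _ /(_ n (leqnn n)) nx] := near_infty_natSinv_lt (PosNum x0).
  by exists n => //=; rewrite in_itv/= nx.
have mE : measurable_fun setT (EFin \o f) by exact/measurable_EFinP.
have cv : (\int[leb]_(x in F i) (f x)%:E @[i --> \oo] --> \int[leb]_(x in `]0%R, b]) (f x)%:E)%E.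
  rewrite -UF; apply: ge0_nondecreasing_set_cvg_integral => //.
  - by move=> i; rewrite /F; exact: measurable_itv.
  - by move=> i; exact: measurable_funTS.
  - move=> i x; rewrite /F/= in_itv/= => /andP[ix xb]; rewrite lee_fin f0// xb andbT.
    by apply: lt_trans ix; rewrite invr_gt0.
have le n : (\int[leb]_(x in F n) (f x)%:E <= M%:E)%E.
  have [In le] := H _ (ltac:(by rewrite invr_gt0) : 0 < (n.+1%:R^-1 : R)).
  have fn : (\int[leb]_(x in F n) (f x)%:E)%E \is a fin_num by refine (integrable_fin_num _ In).
  by rewrite -(fineK fn) lee_fin.
have leM : (\int[leb]_(x in `]0%R, b]) (f x)%:E <= M%:E)%E.
  rewrite -(cvg_lim _ cv)//; apply: lime_le; first by apply/cvg_ex; eexists; exact: cv.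
  by apply: nearW.
have If : itgoc 0 b f.
  apply/integrableP; split; first exact: measurable_funTS.
  have -> : (\int[leb]_(x in `]0%R, b]) `|(EFin \o f) x| =
             \int[leb]_(x in `]0%R, b]) (f x)%:E)%E.
    apply: eq_integral => x; rewrite inE/= in_itv/= => /f0 fx.
    by rewrite ger0_norm.
  by apply: le_lt_trans leM _; rewrite ltry.
split=> //.
rewrite -lee_fin /intoc /Rintegral fineK//; by refine (integrable_fin_num _ If).
Qed.

Lemma measurable_inv : measurable_fun setT (@GRing.inv R).
Proof.
have -> : [set: R] = `]-oo, 0[%classic `|` ([set 0] `|` `]0, +oo[%classic).
  apply/seteqP; split => // x _ /=; rewrite !in_itv/= andbT.
  by case: (ltgtP x 0) => ?; [left|right; right|right; left].
apply/measurable_funU => //; first by apply: measurableU.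
split; last (apply/measurable_funU => //; split).
- apply: open_continuous_measurable_fun; first exact: interval_open.
  by move=> x; rewrite inE/= in_itv/= => x0; apply: continuousV => //; rewrite lt_eqF.
- exact: measurable_fun_set1.
- apply: open_continuous_measurable_fun; first exact: interval_open.
  by move=> x; rewrite inE/= in_itv/= andbT => x0; apply: continuousV => //; rewrite gt_eqF.
Qed.

Lemma measurable_floor : measurable_fun setT (fun x : R => (Num.floor x)%:~R : R).
Proof.
by apply: nondecreasing_measurable => // x y xy; rewrite ler_int; exact: le_floor.
Qed.

Lemma measurable_sqrtr : measurable_fun setT (@Num.sqrt R).
Proof. by apply: continuous_measurable_fun; exact: sqrt_continuous. Qed.

Lemma measurable_isqrt : measurable_fun setT (fun z : R => (Num.sqrt z)^-1).
Proof. exact: measurableT_comp measurable_inv measurable_sqrtr. Qed.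

Lemma itgoc_int_isqrt b : 0 <= b -> itgoc 0 b (fun z => (Num.sqrt z)^-1) /\
  intoc 0 b (fun z => (Num.sqrt z)^-1) <= 2 * Num.sqrt b.
Proof.
move=> b0; apply: ge0_itgoc_lim.
- exact: measurable_isqrt.
- by move=> t _; rewrite invr_ge0 sqrtr_ge0.
move=> e e0; split.
  apply: itgoc_continuous => x /andP[ex xb].
  have x0 : 0 < x by exact: lt_le_trans ex.
  apply: continuousV; first by rewrite gt_eqF// sqrtr_gt0.
  exact: sqrt_continuous.
have [eb|be] := leP e b.
  rewrite intoc_isqrt_pos// lerBlDr lerDl; apply: mulr_ge0 => //; exact: sqrtr_ge0.
rewrite /intoc set_itv_ge; last by rewrite bnd_simp -leNgt ltW.
by rewrite Rintegral_set0 mulr_ge0 ?sqrtr_ge0.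
Qed.

Definition ker (v : R) : R := if v == 0 then 0 else 2^-1 - Defs.frac v^-1.

Lemma KernE x y : Kern x y = ker (x * y). Proof. by []. Qed.

Lemma measurable_ker : measurable_fun setT ker.
Proof.
apply: measurable_fun_ifT => //; first by apply: measurable_fun_eqr.
apply: measurable_funB => //; rewrite /Defs.frac; apply: measurable_funB; first exact: measurable_inv.
exact: measurableT_comp measurable_floor measurable_inv.
Qed.

Lemma frac_itv (a : R) : 0 <= Defs.frac a < 1.
Proof.
rewrite /Defs.frac subr_ge0 floor_le/= ltrBlDr.
by have := floorD1_gt a; rewrite intrD addrC.
Qed.

Lemma ker_bnd v : `|ker v| <= 2^-1.
Proof.
rewrite /ker; case: eqP => _; first by rewrite normr0 invr_ge0.
by have /andP[] := frac_itv v^-1 => ? ?; rewrite ler_norml; lra.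
Qed.

Lemma kerE v : v != 0 -> ker v = 2^-1 + (Num.floor v^-1)%:~R - v^-1.
Proof. by rewrite /ker => /negbTE->; rewrite /Defs.frac; ring. Qed.

End Kernel.

Section KernelPrimitive.
Context {R : realType}.
Implicit Types (a b c s M x y z u v t : R).

Lemma itgoc_ker_scale a b x : itgoc a b (fun z => ker (x * z)).
Proof.
apply: (@itgoc_bounded _ _ _ 2^-1); last by move=> t _; exact: ker_bnd.
by apply: (measurableT_comp measurable_ker); exact: measurable_funM.
Qed.

Lemma itgoc_ker a b : itgoc a b (@ker R).
Proof.
by apply: (@itgoc_bounded _ _ _ 2^-1); [exact: measurable_ker|move=> t _; exact: ker_bnd].
Qed.

(** On this interval the kernel is [1/2 + n - 1/z]. As [1/z] is convex, it lies below its chord and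
    above its midpoint tangent, which bounds the integral on both sides. The upper bound is weakened
    to a difference that telescopes. *)
Lemma intoc_ker_piece (n : nat) : (0 < n)%N ->
  0 <= intoc (n.+1%:R^-1) (n%:R^-1) (@ker R) <= n%:R ^- 2 - n.+1%:R ^- 2.
Proof.
move=> n0; pose p : R := n%:R; have p0 : 0 < p by rewrite ltr0n.
have pS : n.+1%:R = p + 1 :> R by rewrite -natr1.
rewrite pS -/p.
have p10 : 0 < p + 1 by lra.
set a := (p + 1)^-1; set b := p^-1.
have ab : a <= b by rewrite lef_pV2 ?posrE//; lra.
have a0 : 0 < a by rewrite invr_gt0.
have kE z : a < z <= b -> ker z = 2^-1 + p - z^-1.
  move=> /andP[az zb]; have z0 : 0 < z by exact: lt_trans az.
  rewrite kerE ?gt_eqF//; congr (_ + _ - _).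
  rewrite (@floor_def _ _ n%:Z)// intrD/= -[n%:~R]/p.
  rewrite -[p in X in X && _]invrK -/b lef_pV2 ?posrE ?invr_gt0// zb/=.
  by rewrite -[p + 1%:~R]invrK -/a ltf_pV2 ?posrE.
have E1 : a = (p + 1)^-1 by []. have E2 : b = p^-1 by [].
apply/andP; split.
(* Replacing [1/z] by its chord leaves an affine function of integral 0. After multiplication by
   [z], the comparison is [(p z - 1) ((p + 1) z - 1) <= 0]. *)
- apply: le_trans (le_intoc (f := fun z => - (p + 2^-1) + p * (p + 1) * z) _ (itgoc_ker a b) _).
  + rewrite intoc_affine// E1 E2 le_eqVlt; apply/orP; left; apply/eqP; field.
    by rewrite !gt_eqF.
  + by apply: itgoc_continuous => z _; apply: continuousD; [exact: cvg_cst|apply: continuousM; [exact: cvg_cst|]].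
  + move=> z zab; rewrite kE//; case/andP: zab => az zb.
    have z0 : 0 < z by exact: lt_trans az.
    rewrite -(ler_pM2r z0) mulrBl mulVf ?gt_eqF//.
    have h1 : z * p <= 1 by rewrite -ler_pdivlMr// mul1r.
    have h2 : 1 <= z * (p + 1) by rewrite -ler_pdivrMr// mul1r; exact: ltW.
    nra.
(* [m] is the midpoint of [a] and [b]; the tangent bound [1/z >= 2/m - z/m^2] comes from the square
   [(z/m - 1)^2 / z]. *)
- pose m := (2 * p + 1) / (2 * p * (p + 1)).
  have m0 : 0 < m by rewrite divr_gt0 ?mulr_gt0//; lra.
  apply: le_trans (le_intoc (g := fun z => (p + 2^-1 - 2 / m) + m ^- 2 * z) (itgoc_ker a b) _ _) _.
  + by apply: itgoc_continuous => z _; apply: continuousD; [exact: cvg_cst|apply: continuousM; [exact: cvg_cst|]].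
  + move=> z zab; rewrite kE//; case/andP: zab => az zb.
    have z0 : 0 < z by exact: lt_trans az.
    have : 0 <= (z / m - 1) ^+ 2 / z by rewrite divr_ge0 ?sqr_ge0// ltW.
    have -> : (z / m - 1) ^+ 2 / z = m ^- 2 * z - 2 / m + z^-1.
      by field; rewrite !gt_eqF.
    lra.
  + rewrite intoc_affine// E1 E2 /m.
    have -> : (p + 2^-1 - 2 / ((2 * p + 1) / (2 * p * (p + 1)))) * (p^-1 - (p + 1)^-1) +
      ((2 * p + 1) / (2 * p * (p + 1))) ^- 2 * (p^-1 ^+ 2 - (p + 1)^-1 ^+ 2) / 2
      = (p * (p + 1) * 2 * (2 * p + 1))^-1.
      field; rewrite !gt_eqF//; lra.
    have -> : p ^- 2 - (p + 1) ^- 2 = (p * (p + 1) * 2 * (2 * p + 1))^-1 *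
       (2 * (2 * p + 1) ^+ 2 / (p * (p + 1))).
      field; rewrite !gt_eqF//; lra.
    rewrite ler_peMr ?invr_ge0 ?mulr_ge0//; try lra.
    rewrite ler_pdivlMr ?mulr_gt0//; nra.
Qed.

Lemma intoc_ker_pieces (n j : nat) : (0 < n)%N ->
  0 <= intoc ((n + j)%:R^-1) (n%:R^-1) (@ker R) <= n%:R ^- 2 - (n + j)%:R ^- 2.
Proof.
move=> n0; elim: j => [|j /andP[IH1 IH2]]; first by rewrite addn0 intocxx subrr lexx.
have nj0 : (0 < n + j)%N by rewrite addn_gt0 n0.
have /andP[h1 h2] := intoc_ker_piece nj0.
rewrite addnS (@intoc_split _ _ (n + j)%:R^-1).
- by rewrite addr_ge0//= addrC (le_trans (lerD IH2 h2))// subrKA.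
- by rewrite lef_pV2 ?posrE ?ltr0n// ler_nat.
- by rewrite lef_pV2 ?posrE ?ltr0n// ler_nat leq_addr.
- exact: itgoc_ker.
Qed.

(** The telescoped bound holds down to [1 / (n + j)] for every [j], and the remaining interval at 0
    contributes at most half its length, which is arbitrarily small. *)
Lemma intoc_ker_natV (n : nat) : (0 < n)%N ->
  `|intoc 0 n%:R^-1 (@ker R)| <= n%:R ^- 2.
Proof.
move=> n0; apply/ler_addgt0Pr => e e0.
have [j _ /(_ j (leqnn j)) je] := near_infty_natSinv_lt (PosNum e0).
have /andP[h1 h2] := intoc_ker_pieces j.+1 n0.
have nj0 : (0 < n + j.+1)%N by rewrite addn_gt0 n0.
rewrite (@intoc_split _ _ (n + j.+1)%:R^-1) ?invr_ge0//; last 2 first.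
- by rewrite lef_pV2 ?posrE ?ltr0n// ler_nat leq_addr.
- exact: itgoc_ker.
apply: le_trans (ler_normD _ _) _.
have V0 : 0 <= (n + j.+1)%:R^-1 :> R by rewrite invr_ge0.
have h3 := intoc_norm_bnd measurable_ker V0 (fun t _ => ker_bnd t).
have h4 : (n + j.+1)%:R^-1 <= j.+1%:R^-1 :> R.
  by rewrite lef_pV2 ?posrE ?ltr0n// ler_nat leq_addl.
rewrite [X in _ + X]ger0_norm//.
have h5 : 0 <= (n + j.+1)%:R ^- 2 :> R by rewrite invr_ge0 exprn_ge0.
rewrite /= in je; clear h1; move: h2 h3 h4 h5 je V0.
move: (intoc 0 _ _) (intoc _ n%:R^-1 _) => I1 I2.
move: (n%:R ^- 2) ((n + j.+1)%:R ^- 2) ((n + j.+1)%:R^-1) (j.+1%:R^-1).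
by move=> *; lra.
Qed.

(** With [n] the integer part of [1/v], the complete pieces up to [1 / (n + 1)] contribute at most
    [v^2]. The incomplete last piece has length [v - 1 / (n + 1) <= v^2], and the kernel is at most
    [1/2] there. *)
Lemma intoc_ker v : 0 <= v <= 1 -> `|intoc 0 v (@ker R)| <= 2 * v ^+ 2.
Proof.
case/andP; rewrite le_eqVlt => /predU1P[<- _|v0 v1].
  by rewrite intocxx normr0 mulr_ge0// exprn_ge0.
have := floor_itv v^-1; have : 0 < Num.floor v^-1 by rewrite floor_gt0 invf_ge1.
case: (Num.floor v^-1) => // n; rewrite intrD -[n%:~R]/(n%:R) natr1 => n0 /andP[nv vn].
have n0' : 0 < n%:R :> R by rewrite ltr0n.
have av : n.+1%:R^-1 <= v by rewrite -(invrK v) lef_pV2 ?posrE ?invr_gt0// ltW.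
rewrite (@intoc_split _ _ n.+1%:R^-1) ?invr_ge0//; last exact: itgoc_ker.
apply: le_trans (ler_normD _ _) _.
have h1 := intoc_ker_natV (ltn0Sn n).
have h2 := intoc_norm_bnd measurable_ker av (fun t _ => ker_bnd t).
have e1 : v * n%:R <= 1 by rewrite mulrC -ler_pdivlMr// mul1r.
have e2 : v * n.+1%:R <= 1 + v by rewrite -natr1 mulrDr mulr1 lerD2r.
have e3 : n.+1%:R ^- 2 <= v ^+ 2 :> R.
  by rewrite -exprVn ler_pXn2r// nnegrE ?invr_ge0// ltW.
set w := n.+1%:R^-1 in av h2 *.
have w0 : 0 < w by rewrite invr_gt0.
have e4 : v <= w + v * w.
  have : v * n.+1%:R * w <= (1 + v) * w by rewrite ler_pM2r.
  by rewrite -mulrA mulfV// mulr1 mulrDl mul1r.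
have e5 : v * w <= v ^+ 2 by rewrite expr2 ler_pM2l.
move: h1 h2 e3 e4 e5; move: (intoc 0 w _) (intoc w v _) (n.+1%:R ^- 2) => I1 I2 q.
by move=> *; lra.
Qed.

Lemma intoc_ker_scale x u : 0 < x -> 0 <= u -> x * u <= 1 ->
  `|intoc 0 u (fun z => ker (x * z))| <= 2 * x * u ^+ 2.
Proof.
move=> x0 u0 xu1; rewrite intoc_scale//; last 2 first.
- exact: measurable_ker.
- exact: itgoc_ker.
rewrite mulr0 normrM normfV (gtr0_norm x0) mulrC ler_pdivrMr//.
apply: le_trans (intoc_ker _) _; first by rewrite mulr_ge0// ltW.
rewrite le_eqVlt; apply/orP; left; apply/eqP; ring.
Qed.

End KernelPrimitive.

(** * The iterated kernel *)

Section IteratedKernel.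
Context {R : realType}.
Implicit Types (a b c s M x y z u v t : R).

Definition ker2 x y : R := intoc 0 1 (fun z => ker (x * z) * ker (y * z)).

Lemma measurable_ker_scale x : measurable_fun setT (fun z : R => ker (x * z)).
Proof. by apply: (measurableT_comp measurable_ker); exact: measurable_funM. Qed.

Lemma normr_kerM u v : `|ker u * ker v| <= 4^-1 :> R.
Proof.
have h1 := ker_bnd u; have h2 := ker_bnd v.
rewrite normrM (le_trans (ler_pM _ _ h1 h2))//; lra.
Qed.

Lemma itgoc_kerM a b x y : itgoc a b (fun z => ker (x * z) * ker (y * z)).
Proof.
apply: (@itgoc_bounded _ _ _ 4^-1); last by move=> t _; exact: normr_kerM.
by apply: measurable_funM; exact: measurable_ker_scale.
Qed.

Lemma ker2_bnd x y : `|ker2 x y| <= 4^-1.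
Proof.
have -> : 4^-1 = 4^-1 * (1 - 0) :> R by rewrite subr0 mulr1.
apply: intoc_norm_bnd => //; last by move=> t _; exact: normr_kerM.
by apply: measurable_funM; exact: measurable_ker_scale.
Qed.

Lemma intoc_ker_scale_itv x u v : 0 < x <= 1 -> 0 <= u -> u <= v -> v <= 1 ->
  `|intoc u v (fun z => ker (x * z))| <= 4 * x * v ^+ 2.
Proof.
move=> /andP[x0 x1] u0 uv v1; have v0 := le_trans u0 uv.
have -> : intoc u v (fun z => ker (x * z)) =
    intoc 0 v (fun z => ker (x * z)) - intoc 0 u (fun z => ker (x * z)).
  by rewrite (intoc_split u0 uv (itgoc_ker_scale 0 v x)); ring.
apply: le_trans (ler_normB _ _) _.
have h1 := @intoc_ker_scale _ x v x0 v0 (mulr_ile1 (ltW x0) v0 x1 v1).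
have h2 := @intoc_ker_scale _ x u x0 u0 (mulr_ile1 (ltW x0) u0 x1 (le_trans uv v1)).
have : x * u ^+ 2 <= x * v ^+ 2 by rewrite ler_pM2l// ler_pXn2r.
lra.
Qed.

(* {1/(yz)} is the measure of the t with [layer y (z, t) = 1]; for fixed t these z
   form an interval, so after Fubini only the primitive of the kernel occurs. *)
Let layer y (p : measurableTypeR R * measurableTypeR R) : R :=
  if ((Num.floor (y * p.1)^-1)%:~R < p.2) && (p.2 <= (y * p.1)^-1) then 1 else 0.

Let measurable_layer y : measurable_fun setT (layer y).
Proof.
have mi : measurable_fun setT (fun p : measurableTypeR R * measurableTypeR R => (y * p.1)^-1).
  apply: measurableT_comp; first exact: measurable_inv.
  by apply: measurable_funM.
apply: measurable_fun_ifT => //.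
apply: measurable_and.
- apply: measurable_fun_ltr => //.
  exact: (measurableT_comp measurable_floor mi).
- by apply: measurable_fun_ler.
Qed.

Let layer_bnd y p : `|layer y p| <= 1.
Proof. by rewrite /layer; case: ifP => _; rewrite ?normr1 ?normr0. Qed.

Let intoc_layer y z T : 0 < y -> 0 < z -> (y * z)^-1 <= T ->
  intoc 0 T (fun t => layer y (z, t)) = Defs.frac (y * z)^-1.
Proof.
move=> y0 z0 aT; set a := (y * z)^-1 in aT *.
have a0 : 0 <= a by rewrite invr_ge0 mulr_ge0 ?ltW.
rewrite (@intoc_restrict _ _ _ (Num.floor a)%:~R a (fun=> 1)).
- rewrite max_r ?ler0z ?floor_ge0// min_r// intoc_cst ?floor_le// mul1r //.
- by move=> t _ h; rewrite /layer/= -/a h.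
- by move=> t _ /negbTE h; rewrite /layer/= -/a h.
Qed.

(** [floor a < t] holds exactly when [a < ceil t]. With [a = 1/(y z)], both conditions can thus be
    solved for [z], and they describe a half-open interval. *)
Let layerE y z t : 0 < y -> 0 < z -> 0 < t ->
  layer y (z, t) =
  if (y * (Num.ceil t)%:~R)^-1 < z <= (y * t)^-1 then 1 else 0.
Proof.
move=> y0 z0 t0; rewrite /layer/= -ceil_gt_int floor_lt_int.
have c0 : 0 < (Num.ceil t)%:~R :> R by apply: lt_le_trans t0 _; exact: ceil_ge.
congr (if _ && _ then _ else _).
- by rewrite invf_plt ?posrE ?mulr_gt0// [in RHS]invfM ltr_pdivrMl.
- rewrite -[(y * z)^-1]mul1r -[(y * t)^-1]mul1r !ler_pdivlMr ?mulr_gt0//.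
  by congr (_ <= _); ring.
Qed.

Let intoc_ker_layer x y e t : 0 < x <= 1 -> 0 < y -> 0 < e -> e <= 1 ->
  0 < t -> t <= (y * e)^-1 ->
  `|intoc e 1 (fun z => ker (x * z) * layer y (z, t))|
    <= 4 * x * (Num.min 1 (y * t)^-1) ^+ 2.
Proof.
move=> x01 y0 e0 e1 t0 te; have x0 : 0 < x by case/andP: x01.
pose q := (y * t)^-1; pose p := (y * (Num.ceil t)%:~R)^-1.
rewrite (@intoc_restrict _ _ _ p q (fun z => ker (x * z))); last 2 first.
- move=> z /andP[ez z1] h; rewrite layerE ?(lt_trans e0 ez)//.
  by rewrite h mulr1.
- move=> z /andP[ez z1] /negbTE h; rewrite layerE ?(lt_trans e0 ez)//.
  by rewrite h mulr0.
set u := Num.max e p; set v := Num.min 1 q.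
have [uv|vu] := leP u v.
  apply: intoc_ker_scale_itv => //; last by rewrite ge_min lexx.
  by rewrite le_max ltW.
rewrite /intoc set_itv_ge; last by rewrite bnd_simp -leNgt ltW.
by rewrite Rintegral_set0 normr0 !mulr_ge0 ?exprn_ge0 ?ltW// lt_min ltr01 invr_gt0 mulr_gt0.
Qed.

(** Writing the fractional part as an integral of layers and exchanging the order leaves
    [4 x min(1, 1/(y t))^2] to be integrated over [t]. The oscillation of the kernel in [z] is thus
    used before any absolute value is taken. *)
Let intoc_ker_frac x y e : 0 < x <= 1 -> 0 < y -> y <= 1 -> 0 < e -> e <= 1 ->
  `|intoc e 1 (fun z => ker (x * z) * Defs.frac (y * z)^-1)| <= 8 * x / y.
Proof.
move=> x01 y0 y1 e0 e1; have x0 : 0 < x by case/andP: x01.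
(* [T] dominates [1/(y z)] for all [z > e]; the cutoff [e] is what makes the Fubini rectangle
   bounded. *)
pose T := (y * e)^-1.
pose F (p : measurableTypeR R * measurableTypeR R) : R := ker (x * p.1) * layer y p.
have mF : measurable_fun setT F.
  apply: measurable_funM; last exact: measurable_layer.
  exact: (measurableT_comp (measurable_ker_scale x)).
have FM z t : `|F (z, t)| <= 2^-1.
  rewrite normrM -[2^-1]mulr1; apply: ler_pM => //; exact: ker_bnd.
have yT : y^-1 <= T.
  by rewrite /T lef_pV2 ?posrE ?mulr_gt0// ler_piMr// ltW.
have y'0 : 0 < y^-1 by rewrite invr_gt0.
have -> : intoc e 1 (fun z => ker (x * z) * Defs.frac (y * z)^-1) =
    intoc e 1 (fun z => intoc 0 T (fun t => F (z, t))).
  apply: eq_intoc => z /andP[ez z1]; have z0 : 0 < z by exact: lt_trans ez.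
  rewrite -(@intoc_layer y z T)//; last first.
    by rewrite /T lef_pV2 ?posrE ?mulr_gt0// ler_pM2l// ltW.
  rewrite /F/= intocZ//.
  apply: (@itgoc_bounded _ _ _ 1) => //.
  exact: (measurableT_comp (measurable_layer y)).
rewrite (intoc_fubini mF (fun z t _ _ => FM z t)).
have IH : itgoc 0 T (fun t => intoc e 1 (fun z => F (z, t))).
  have mF' : measurable_fun setT (fun p : measurableTypeR R * measurableTypeR R => F (p.2, p.1)).
    by apply: (measurableT_comp mF); exact: measurable_swap.
  exact: (itgoc_int mF' (fun t z _ _ => FM z t)).
(* The minimum of 1 and [1/(y t)] switches at [t = 1/y]; each side contributes [4 x / y]. *)
rewrite (intoc_split (ltW y'0) yT IH).
apply: le_trans (ler_normD _ _) _.
have -> : 8 * x / y = 4 * x * (y^-1 - 0) + 4 * x * y ^- 2 * y.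
  by field; rewrite gt_eqF.
apply: lerD.
- rewrite -(@intoc_cst _ 0 y^-1 (4 * x)) ?(ltW y'0)//; apply: intoc_norm_le_itg.
  + by apply: itgoc_sub IH.
  + exact: itgoc_cst.
  + move=> t /andP[t0 ty]; apply: le_trans (intoc_ker_layer _ _ _ _ _ _) _ => //.
      exact: le_trans ty yT.
    have x4 : 0 <= 4 * x by rewrite mulr_ge0// ltW.
    rewrite ler_piMr// expr_le1 ?ge_min ?lexx//.
    by rewrite le_min ler01 invr_ge0 mulr_ge0// ltW.
- apply: le_trans (_ : intoc y^-1 T (fun t => 4 * x * y ^- 2 * (t ^+ 2)^-1) <= _).
    apply: intoc_norm_le_itg.
    + by apply: itgoc_sub IH => //; exact: ltW.
    + apply: itgocZ; apply: itgoc_continuous => t /andP[yt tT].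
      have t0 : 0 < t by exact: lt_le_trans yt.
      apply: continuousV; first by rewrite gt_eqF// exprn_gt0.
      exact: exprn_continuous.
    + move=> t /andP[yt tT]; have t0 : 0 < t by exact: lt_trans yt.
      apply: le_trans (intoc_ker_layer _ _ _ _ _ _) _ => //.
      rewrite -!mulrA !ler_pM2l// -invfM -exprMn -exprVn.
      apply: lerXn2r; rewrite ?nnegrE ?invr_ge0 ?mulr_ge0 ?(ltW y0) ?(ltW t0)//.
      + by rewrite le_min ler01 invr_ge0 mulr_ge0// ltW.
      + by rewrite ge_min lexx orbT.
  rewrite intocZ; last first.
    apply: itgoc_continuous => t /andP[yt tT].
    have t0 : 0 < t by exact: lt_le_trans yt.
    apply: continuousV; first by rewrite gt_eqF// exprn_gt0.
    exact: exprn_continuous.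
  rewrite intoc_invsq// invrK ler_wpM2l//.
    by rewrite !mulr_ge0 ?invr_ge0 ?exprn_ge0 ?ltW.
  by rewrite gerBl invr_ge0 invr_ge0 mulr_ge0 ?ltW.
Qed.

(** With [ker (y z) = 1/2 - frac (1/(y z))], the constant part gives [2 x] and the fractional part
    [8 x / y]. The interval []0, e]] costs [e / 4], where [e] is arbitrarily small. *)
Lemma ker2_le x y : 0 < x <= 1 -> 0 < y <= 1 -> `|ker2 x y| <= 10 * x / y.
Proof.
move=> x01 /andP[y0 y1]; have /andP[x0 x1] := x01.
apply/ler_addgt0Pr => e' e'0; pose e := Num.min e' 1.
have e0 : 0 < e by rewrite lt_min e'0 ltr01.
have e1 : e <= 1 by rewrite ge_min lexx orbT.
have ee' : e <= e' by rewrite ge_min lexx.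
rewrite /ker2 (intoc_split (ltW e0) e1 (itgoc_kerM 0 1 x y)).
have h1 : `|intoc 0 e (fun z => ker (x * z) * ker (y * z))| <= 4^-1 * (e - 0).
  apply: intoc_norm_bnd => //; [|exact: ltW|by move=> t _; exact: normr_kerM].
  by apply: measurable_funM; exact: measurable_ker_scale.
have mfr : measurable_fun setT (fun z : R => Defs.frac (y * z)^-1).
  rewrite /Defs.frac; apply: measurable_funB.
    by apply: (measurableT_comp measurable_inv); exact: measurable_funM.
  apply: (measurableT_comp measurable_floor).
  by apply: (measurableT_comp measurable_inv); exact: measurable_funM.
have h2 : intoc e 1 (fun z => ker (x * z) * ker (y * z)) =
    2^-1 * intoc e 1 (fun z => ker (x * z)) -
    intoc e 1 (fun z => ker (x * z) * Defs.frac (y * z)^-1).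
  rewrite -intocZ; last exact: itgoc_ker_scale.
  rewrite -intocB.
  - apply: eq_intoc => z /andP[ez z1]; have z0 : 0 < z by exact: lt_trans ez.
    by rewrite [ker (y * z)]/ker gt_eqF ?mulr_gt0//; ring.
  - by apply: itgocZ; exact: itgoc_ker_scale.
  - apply: (@itgoc_bounded _ _ _ 2^-1).
      by apply: measurable_funM => //; exact: measurable_ker_scale.
    move=> z _; rewrite normrM -[2^-1]mulr1; apply: ler_pM => //; first exact: ker_bnd.
    by have /andP[f0 f1] := frac_itv (y * z)^-1; rewrite ger0_norm// ltW.
have h3 := intoc_ker_scale_itv x01 (ltW e0) e1 (lexx 1).
have h4 := intoc_ker_frac x01 y0 y1 e0 e1.
have h5 : x <= x / y by rewrite ler_peMr ?invf_ge1// ltW.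
rewrite h2; apply: le_trans (ler_normD _ _) _.
apply: le_trans (lerD h1 (ler_normB _ _)) _.
rewrite normrM ger0_norm ?invr_ge0// expr1n mulr1 in h3 *.
move: h3 h4; move: (intoc e 1 _) (intoc e 1 _) => I1 I2 h3 h4.
rewrite -mulrA in h4; rewrite -mulrA; move: h4 h5; move: (x / y) => w *.
lra.
Qed.

End IteratedKernel.

(** * Elementary bounds for the logarithm *)

Section LogBounds.
Context {R : realType}.
Implicit Types (x y z w : R).

Lemma ln_le_subr1 x : 0 < x -> ln x <= x - 1.
Proof.
by move=> x0; have := @expR_ge1Dx R (ln x); rewrite lnK ?posrE//; lra.
Qed.

Lemma lnV_ge0 x : 0 < x <= 1 -> 0 <= ln x^-1.
Proof. by move=> /andP[x0 x1]; rewrite ln_ge0// invf_ge1. Qed.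

Lemma ln_sqrt x : 0 < x -> ln x = 2 * ln (Num.sqrt x).
Proof.
move=> x0; rewrite -{1}(sqr_sqrtr (ltW x0)) lnXn ?sqrtr_gt0//.
by rewrite mulr_natl.
Qed.

Lemma ln_inv_le_isqrt x : 0 < x -> ln x^-1 <= 2 * (Num.sqrt x)^-1 - 2.
Proof.
move=> x0; rewrite lnV ?posrE// ln_sqrt//.
have s0 : 0 < Num.sqrt x by rewrite sqrtr_gt0.
have := @ln_le_subr1 (Num.sqrt x)^-1 (ltac:(by rewrite invr_gt0)).
by rewrite lnV ?posrE//; lra.
Qed.

Lemma ln2_ge : 2^-1 <= ln 2 :> R.
Proof.
have := @ln_le_subr1 2^-1 (ltac:(by rewrite invr_gt0)).
by rewrite lnV ?posrE//; lra.
Qed.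

Lemma sqrtr_le1 x : x <= 1 -> Num.sqrt x <= 1.
Proof. by move=> x1; rewrite -[leRHS]sqrtr1 ler_sqrt. Qed.

End LogBounds.

(** * Applying the kernel twice *)

Section IteratedFubini.
Context {R : realType}.
Implicit Types (a b c s M x y z u v t : R).

Let integrand z s (th : R -> R) (p : measurableTypeR R * measurableTypeR R) : R :=
  ker (z * p.1) * (ker (p.1 * (s * p.2)) * th p.2).

Let measurable_integrand z s (th : R -> R) : measurable_fun setT th ->
  measurable_fun setT (integrand z s th).
Proof.
move=> mth; apply: measurable_funM; last apply: measurable_funM.
- exact: (measurableT_comp (measurable_ker_scale z)).
- apply: (measurableT_comp measurable_ker); apply: measurable_funM => //.
  by apply: measurable_funM.
- exact: measurableT_comp.
Qed.

Let integrand_bnd z s c d M (th : R -> R) : (forall w, c < w <= d -> `|th w| <= M) ->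
  forall y w, 0 < y <= 1 -> c < w <= d -> `|integrand z s th (y, w)| <= M.
Proof.
move=> thM y w _ wcd; rewrite /integrand/= mulrA normrM.
apply: le_trans (_ : 1 * `|th w| <= _); last by rewrite mul1r; exact: thM.
rewrite ler_wpM2r//; apply: le_trans (normr_kerM _ _) _; lra.
Qed.

Let itgoc_inner c d y s M (th : R -> R) : measurable_fun setT th ->
  (forall w, c < w <= d -> `|th w| <= M) ->
  itgoc c d (fun w => ker (y * (s * w)) * th w).
Proof.
move=> mth thM; apply: (@itgoc_bounded _ _ _ M).
  apply: measurable_funM => //; apply: (measurableT_comp (measurable_ker_scale y)).
  exact: measurable_funM.
move=> w wcd; rewrite normrM; apply: le_trans (_ : 1 * `|th w| <= _).
  rewrite ler_wpM2r//; apply: le_trans (ker_bnd _) _; lra.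
by rewrite mul1r; exact: thM.
Qed.

Lemma itgoc_ker_int z s c d M (th : R -> R) : measurable_fun setT th ->
  (forall w, c < w <= d -> `|th w| <= M) ->
  itgoc 0 1 (fun y => ker (z * y) * intoc c d (fun w => ker (y * (s * w)) * th w)).
Proof.
move=> mth thM.
have := itgoc_int (measurable_integrand z s mth) (integrand_bnd z s thM).
apply: eq_integrable => // y _ /=; rewrite /integrand/= intocZ//.
exact: itgoc_inner thM.
Qed.

(** The dilation [s] is a parameter because both cases occur: [s = 1] with the eigenfunction and
    [s < 1] with its difference quotient. *)
Lemma intoc_ker_int z s c d M (th : R -> R) : measurable_fun setT th ->
  (forall w, c < w <= d -> `|th w| <= M) ->
  intoc 0 1 (fun y => ker (z * y) * intoc c d (fun w => ker (y * (s * w)) * th w)) =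
  intoc c d (fun w => ker2 z (s * w) * th w).
Proof.
move=> mth thM.
have := intoc_fubini (measurable_integrand z s mth) (integrand_bnd z s thM).
have -> : intoc 0 1 (fun y => intoc c d (fun w => integrand z s th (y, w))) =
  intoc 0 1 (fun y => ker (z * y) * intoc c d (fun w => ker (y * (s * w)) * th w)).
  by apply: eq_intoc => y _; rewrite /integrand/= intocZ//; exact: itgoc_inner thM.
move=> ->; apply: eq_intoc => w _; rewrite mulrC -intocZ; last exact: itgoc_kerM.
by apply: eq_intoc => y _; rewrite /integrand/= [y * _]mulrC; ring.
Qed.

Lemma intoc_minV x : 0 < x <= 1 ->
  itgoc 0 1 (fun w => Num.min 4^-1 (10 * x / w)) /\
  intoc 0 1 (fun w => Num.min 4^-1 (10 * x / w)) <= 10 * x * (1 + ln x^-1).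
Proof.
move=> /andP[x0 x1].
have m0 w : 0 < w -> 0 <= Num.min 4^-1 (10 * x / w).
  by move=> w0; rewrite le_min invr_ge0 divr_ge0 ?mulr_ge0 ?(ltW x0) ?(ltW w0)// ler0n.
have mm : measurable_fun setT (fun w : R => Num.min 4^-1 (10 * x / w)).
  apply: measurable_minr => //; apply: measurable_funM => //; exact: measurable_inv.
have I : itgoc 0 1 (fun w => Num.min 4^-1 (10 * x / w)).
  apply: (@itgoc_bounded _ _ _ 4^-1) => // t /andP[t0 _].
  by rewrite ger0_norm ?m0// ge_min lexx.
(* The two bounds cross at [w = 40 * x], which may exceed 1; splitting at [x] instead costs only a
   constant. *)
split=> //; rewrite (intoc_split (ltW x0) x1 I).
apply: le_trans (_ : 4^-1 * (x - 0) + (10 * x) * intoc x 1 (fun w => w^-1) <= _).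
  apply: lerD.
    rewrite -intoc_cst ?(ltW x0)//; apply: le_intoc; last by move=> t _; rewrite ge_min lexx.
      by apply: itgoc_sub I.
    exact: itgoc_cst.
  have IV : itgoc x 1 (fun w => w^-1) by exact: itgoc_inv.
  rewrite -intocZ//; apply: le_intoc.
  - by apply: itgoc_sub I => //; exact: ltW.
  - exact: itgocZ.
  - by move=> t _; rewrite ge_min lexx orbT.
rewrite intoc_inv// ln1 sub0r -lnV ?posrE//; lra.
Qed.

(** The bound of [ker2_le] depends on a ratio only, so a common dilation of the arguments leaves it
    unchanged. *)
Lemma ker2_min s x w : 0 < s <= 1 -> 0 < x <= 1 -> 0 < w <= 1 ->
  `|ker2 (s * x) (s * w)| <= Num.min 4^-1 (10 * x / w).
Proof.
move=> /andP[s0 s1] /andP[x0 x1] /andP[w0 w1]; rewrite le_min ker2_bnd/=.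
apply: le_trans (ker2_le _ _) _.
- by rewrite mulr_gt0// mulr_ile1// ltW.
- by rewrite mulr_gt0// mulr_ile1// ltW.
rewrite le_eqVlt; apply/orP; left; apply/eqP; field; by rewrite !gt_eqF.
Qed.

End IteratedFubini.

(** * Dilations of the kernel *)

Section DilationDifference.
Context {R : realType}.
Implicit Types (s x y z u v t : R).

Let N (v : R) : R := (Num.floor v^-1)%:~R.

Let measurable_N x : measurable_fun setT (fun y => N (x * y)).
Proof.
apply: (measurableT_comp measurable_floor).
by apply: (measurableT_comp measurable_inv); exact: measurable_funM.
Qed.

Let N_ge0 v : 0 < v -> 0 <= N v.
Proof. by move=> v0; rewrite ler0z floor_ge0 invr_ge0 ltW. Qed.

Let N_le v : N v <= v^-1. Proof. exact: floor_le. Qed.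

Let N_mul_le x y c : 0 <= c -> N (x * y) * c <= x^-1 * (c / y).
Proof.
move=> c0; have -> : x^-1 * (c / y) = (x * y)^-1 * c by rewrite invfM; ring.
exact: ler_wpM2r.
Qed.

(** The kernel difference is the increase of the floor minus the increase of [1/v]. Both are
    nonnegative, so their sum dominates. *)
Lemma normr_ker_diff s v : 0 < s <= 1 -> 0 < v ->
  `|ker (s * v) - ker v| <=
  (s^-1 - 1) * v^-1 + ((Num.floor (s * v)^-1)%:~R - (Num.floor v^-1)%:~R).
Proof.
move=> /andP[s0 s1] v0; rewrite !kerE ?gt_eqF ?mulr_gt0//.
have h1 : v^-1 <= (s * v)^-1.
  by rewrite lef_pV2 ?posrE ?mulr_gt0// ler_piMl// ltW.
have h2 : (Num.floor v^-1)%:~R <= (Num.floor (s * v)^-1)%:~R :> R.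
  by rewrite ler_int; exact: le_floor.
have h3 : (s^-1 - 1) * v^-1 = (s * v)^-1 - v^-1 by rewrite invfM; ring.
rewrite h3; rewrite ler_norml; lra.
Qed.

(* The floor part telescopes under the dilation y -> s * y, since the weight b
   satisfies b (u / s) <= b u / s. *)
Lemma intoc_ker_diff s x y0 (f b : R -> R) : 2^-1 <= s < 1 -> 0 < x -> 0 <= y0 ->
  measurable_fun setT f -> measurable_fun setT b ->
  (forall y, 0 <= b y) -> (forall u, 0 < u -> b (u / s) <= b u / s) ->
  (forall y, 0 < y <= y0 -> `|f y| <= b y) -> itgoc 0 y0 (fun y => b y / y) ->
  `|intoc 0 y0 (fun y => (ker (s * x * y) - ker (x * y)) * f y)| <=
  10 * (1 - s) / x * intoc 0 y0 (fun y => b y / y).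
Proof.
move=> /andP[s2 s1] x0 y00 mf mb b0 bs fb Ib.
have s0 : 0 < s by apply: lt_le_trans s2; rewrite invr_gt0.
have s'1 : 1 <= s^-1 by rewrite invf_ge1// ltW.
have sx0 : 0 < s * x by rewrite mulr_gt0.
set B := intoc 0 y0 (fun y => b y / y) in Ib *.
have INx z : 0 < z -> itgoc 0 y0 (fun y => N (z * y) * b y).
  move=> z0; apply: itgoc_le (itgocZ z^-1 Ib).
    by apply: measurable_funM => //; exact: measurable_N.
  move=> y /andP[y1 _]; have zy : 0 < z * y by rewrite mulr_gt0.
  rewrite normrM !ger0_norm ?b0 ?N_ge0//.
  exact: N_mul_le.
have bound : `|intoc 0 y0 (fun y => (ker (s * x * y) - ker (x * y)) * f y)| <=
    intoc 0 y0 (fun y => (s^-1 - 1) / x * (b y / y) +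
                       (N (s * x * y) * b y - N (x * y) * b y)).
  apply: intoc_norm_le.
  - by apply: measurable_funM => //; apply: measurable_funB; exact: measurable_ker_scale.
  - apply: itgocD; first exact: itgocZ.
    by apply: itgocB; exact: INx.
  - move=> y y01; have /andP[y1 _] := y01; rewrite normrM.
    have xy : 0 < x * y by rewrite mulr_gt0.
    have h := @normr_ker_diff s (x * y) (ltac:(by rewrite s0 ltW)) xy.
    rewrite mulrA in h.
    apply: le_trans (ler_pM _ _ h (fb _ y01)) _ => //.
    rewrite -/(N _) -/(N _) invfM -mulrBl !mulrDl !mulrA.
    by rewrite le_eqVlt; apply/orP; left; apply/eqP; field; rewrite !gt_eqF.
apply: le_trans bound _.
rewrite intocD; [|exact: itgocZ|by apply: itgocB; exact: INx].
rewrite intocZ// -/B intocB; [|exact: INx|exact: INx].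
have NB : intoc 0 y0 (fun y => N (x * y) * b y) <= x^-1 * B.
  rewrite /B -intocZ//; apply: le_intoc; [exact: INx|exact: itgocZ|].
  by move=> y _; exact: N_mul_le.
have NB0 : 0 <= intoc 0 y0 (fun y => N (x * y) * b y).
  by apply: intoc_ge0 => y /andP[y1 _]; rewrite mulr_ge0// N_ge0// mulr_gt0.
have sy : s * y0 <= y0 by rewrite ler_piMl// ltW.
(* [h] is chosen so that [h (s * y) = N (s * x * y) * b y]. Rescaling yields one factor [1/s] and
   the condition on [b] a second, while the domain only shrinks. *)
pose h u := N (x * u) * b (u / s).
have mh : measurable_fun setT h.
  apply: measurable_funM; first exact: measurable_N.
  by apply: (measurableT_comp mb); exact: measurable_funM.
have hle u : 0 < u <= s * y0 -> `|h u| <= s^-1 * (N (x * u) * b u).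
  move=> /andP[u0 _]; rewrite normrM !ger0_norm ?b0 ?N_ge0 ?mulr_gt0//.
  by rewrite [leRHS]mulrCA ler_wpM2l ?N_ge0 ?mulr_gt0// [leRHS]mulrC bs.
have INs : itgoc 0 (s * y0) (fun y => N (x * y) * b y) by apply: itgoc_sub (INx _ x0).
have Ih : itgoc 0 (s * y0) h by apply: itgoc_le hle _ => //; exact: itgocZ.
have NsB : intoc 0 y0 (fun y => N (s * x * y) * b y) <=
    s^-1 * (s^-1 * intoc 0 y0 (fun y => N (x * y) * b y)).
  have -> : intoc 0 y0 (fun y => N (s * x * y) * b y) = intoc 0 y0 (fun y => h (s * y)).
    apply: eq_intoc => y _; rewrite /h [s * y]mulrC mulfK ?gt_eqF//.
    by congr (N _ * _); ring.
  rewrite intoc_scale// ?mulr0//.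
  rewrite ler_pM2l ?invr_gt0//.
  apply: le_trans (_ : intoc 0 (s * y0) (fun u => s^-1 * (N (x * u) * b u)) <= _).
    apply: le_intoc => //; first exact: itgocZ.
    by move=> u /hle; apply: le_trans; exact: ler_norm.
  rewrite intocZ// ler_pM2l ?invr_gt0//.
  have sy0 : 0 <= s * y0 by rewrite mulr_ge0// ltW.
  rewrite [leRHS](intoc_split sy0 sy (INx _ x0)) lerDl.
  apply: intoc_ge0 => y /andP[y1 _]; rewrite mulr_ge0// N_ge0// mulr_gt0//.
  exact: le_lt_trans y1.
have s'e : s * s^-1 = 1 by rewrite mulfV// gt_eqF.
set I0 := intoc 0 y0 _ in NB NB0 NsB *; set I1 := intoc 0 y0 _ in NsB *.
set X := x^-1 * B in NB.
have -> : 10 * (1 - s) / x * B = 10 * (1 - s) * X by rewrite /X; ring.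
have -> : (s^-1 - 1) / x * B = (s^-1 - 1) * X by rewrite /X; ring.
move: s'e s'1 NsB; move: (s^-1) => r rs r1 NsB.
have X0 : 0 <= X by exact: le_trans NB.
(* The constant 10 is [2 + 8]: the smooth part costs [1/s - 1 <= 2 (1 - s)] and the floor part
   [1/s^2 - 1 <= 8 (1 - s)], both by [s >= 1/2]. *)
have r2 : r <= 2 by nra.
have h1 : r - 1 <= 2 * (1 - s) by nra.
have h2 : r * r - 1 <= 8 * (1 - s) by nra.
have h3 : (r - 1) * X <= 2 * (1 - s) * X by rewrite ler_wpM2r.
have h4 : (r * r - 1) * I0 <= (r * r - 1) * X by rewrite ler_wpM2l//; nra.
have h5 : (r * r - 1) * X <= 8 * (1 - s) * X by rewrite ler_wpM2r.
rewrite mulrA in NsB; lra.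
Qed.

End DilationDifference.

(** * Difference quotients of an eigenfunction *)

(* Locked, so that unification never unfolds the numeral. *)
Definition dquot_cst {R : realType} : R := locked 1300.

Lemma dquot_cstE {R : realType} : dquot_cst = 1300 :> R.
Proof. by rewrite /dquot_cst -lock. Qed.

Lemma dquot_cst_ge {R : realType} : 43 <= dquot_cst :> R.
Proof. by rewrite dquot_cstE ler_nat. Qed.

Section Eigenfunction.
Context {R : realType} (f : R -> R) (lam : R).
Implicit Types (s x y z u v t w : R).
Local Notation L := `|lam|.
Local Notation l := (ln `|lam|).
Local Notation K := (@dquot_cst R).

(** These four properties are derived in [EigenNormalised] for a normalised eigenfunction extended
    by zero outside the unit interval. *)
Hypothesis mf : measurable_fun setT f.
Hypothesis L2 : 2 <= L.
Hypothesis fb : forall t, `|f t| <= L / 2.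
Hypothesis fE : forall x, 0 < x <= 1 ->
  f x = lam * intoc 0 1 (fun y => ker (x * y) * f y).

Let L0 : 0 < L. Proof. by apply: lt_le_trans L2. Qed.
Let l2 : 2^-1 <= l.
Proof. by apply: le_trans ln2_ge _; rewrite ler_ln ?posrE. Qed.

Let L_le_cube : L <= L ^+ 3 / 4. Proof. by have := L2; nra. Qed.
Let sqr_le_cube : L ^+ 2 <= L ^+ 3 / 2. Proof. by have := L2; nra. Qed.
Let Ll_ge1 : 1 <= L * l. Proof. by have := L2; have := l2; nra. Qed.

Let measurable_kerf x : measurable_fun setT (fun y => ker (x * y) * f y).
Proof. by apply: measurable_funM => //; exact: measurable_ker_scale. Qed.

Let kerf_bnd x y : `|ker (x * y) * f y| <= L / 4.
Proof.
have h1 := ker_bnd (x * y); have h2 := fb y.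
rewrite normrM (le_trans (ler_pM _ _ h1 h2))//; lra.
Qed.

Let itgoc_kerf a b x : itgoc a b (fun y => ker (x * y) * f y).
Proof. by apply: (@itgoc_bounded _ _ _ (L / 4)). Qed.

Lemma eigen_ker2 x : 0 < x <= 1 ->
  f x = lam ^+ 2 * intoc 0 1 (fun w => ker2 x w * f w).
Proof.
move=> x01; rewrite fE// expr2 -mulrA; congr (_ * _).
have fM w : 0 < w <= 1 -> `|f w| <= L / 2 by move=> _; exact: fb.
have := intoc_ker_int x 1 mf fM.
have -> : intoc 0 1 (fun w => ker2 x (1 * w) * f w) = intoc 0 1 (fun w => ker2 x w * f w).
  by apply: eq_intoc => w _; rewrite mul1r.
move=> <-; have I := itgoc_ker_int x 1 mf fM.
rewrite -intocZ//; apply: eq_intoc => y y01; rewrite mulrCA; congr (_ * _).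
by rewrite fE//; congr (_ * _); apply: eq_intoc => w _; rewrite mul1r.
Qed.

Let itgoc_ker2f z s (th : R -> R) M : measurable_fun setT th ->
  (forall w, 0 < w <= 1 -> `|th w| <= M) ->
  itgoc 0 1 (fun w => ker2 z (s * w) * th w).
Proof.
move=> mth thM.
pose F (p : measurableTypeR R * measurableTypeR R) : R :=
  (ker (z * p.2) * ker (s * p.1 * p.2)) * th p.1.
have mF : measurable_fun setT F.
  apply: measurable_funM; last exact: measurableT_comp.
  apply: measurable_funM; first exact: (measurableT_comp (measurable_ker_scale z)).
  apply: (measurableT_comp measurable_ker); apply: measurable_funM => //.
  exact: measurable_funM.
have FM w y : 0 < w <= 1 -> 0 < y <= 1 -> `|F (w, y)| <= M.
  move=> w01 _; rewrite /F/= normrM.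
  apply: le_trans (_ : 1 * `|th w| <= _); last by rewrite mul1r; exact: thM.
  rewrite ler_wpM2r//; apply: le_trans (normr_kerM _ _) _; lra.
have := itgoc_int mF FM; apply: eq_integrable => // w _ /=.
congr EFin; rewrite /F/= [RHS]mulrC /ker2 -intocZ; last exact: itgoc_kerM.
by apply: eq_intoc => y _; rewrite mulrC.
Qed.

Lemma eigen_le x : 0 < x <= 1 -> `|f x| <= 5 * L ^+ 3 * (x * (1 + ln x^-1)).
Proof.
move=> x01; have [I1 I2] := intoc_minV x01.
have fM w : 0 < w <= 1 -> `|f w| <= L / 2 by move=> _; exact: fb.
have J : `|intoc 0 1 (fun w => ker2 x w * f w)| <= L / 2 * (10 * x * (1 + ln x^-1)).
  apply: le_trans (_ : intoc 0 1 (fun w => L / 2 * Num.min 4^-1 (10 * x / w)) <= _).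
    apply: intoc_norm_le_itg; [|exact: itgocZ|].
      have := itgoc_ker2f x 1 mf fM; apply: eq_integrable => // w _ /=.
      by rewrite mul1r.
    move=> w w01; rewrite normrM mulrC; apply: ler_pM => //.
    have := @ker2_min _ 1 x w; rewrite !mul1r; apply=> //.
    by rewrite ltr01 lexx.
  by rewrite intocZ// ler_wpM2l// divr_ge0// ltW.
rewrite (eigen_ker2 x01) normrM normrX.
have -> : 5 * L ^+ 3 * (x * (1 + ln x^-1)) =
    L ^+ 2 * (L / 2 * (10 * x * (1 + ln x^-1))) by field.
by rewrite ler_wpM2l ?exprn_ge0.
Qed.

(** This supplies a weight for [intoc_ker_diff]: the square root is nonnegative everywhere, meets
    the scaling condition, and stays integrable at 0 after division by [y]. *)
Lemma eigen_le_sqrt x : 0 < x <= 1 -> `|f x| <= 10 * L ^+ 3 * Num.sqrt x.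
Proof.
move=> x01; have /andP[x0 x1] := x01; apply: le_trans (eigen_le x01) _.
have s0 : 0 < Num.sqrt x by rewrite sqrtr_gt0.
have h := ln_inv_le_isqrt x0.
have h2 : x * (1 + ln x^-1) <= 2 * Num.sqrt x.
  have -> : 2 * Num.sqrt x = x * (2 * (Num.sqrt x)^-1).
    move: (sqr_sqrtr (ltW x0)) s0; move: (Num.sqrt x) => q <- q0.
    by field; rewrite gt_eqF.
  rewrite ler_pM2l//; lra.
have -> : 10 * L ^+ 3 * Num.sqrt x = 5 * L ^+ 3 * (2 * Num.sqrt x) by ring.
by rewrite ler_wpM2l// mulr_ge0// exprn_ge0.
Qed.

Definition dquot s y := (f y - f (s * y)) / (1 - s).

Lemma measurable_dquot s : measurable_fun setT (dquot s).
Proof.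
apply: measurable_funM => //; apply: measurable_funB => //.
by apply: (measurableT_comp mf); exact: measurable_funM.
Qed.

Lemma dquot_bnd s y : 0 < s < 1 -> `|dquot s y| <= L / (1 - s).
Proof.
move=> /andP[s0 s1]; have s'0 : 0 < 1 - s by lra.
rewrite normrM normfV [`|1 - s|]gtr0_norm// ler_pM2r ?invr_gt0//.
apply: le_trans (ler_normB _ _) _; have h1 := fb y; have h2 := fb (s * y); lra.
Qed.

Lemma itgoc_ker_dquot a b s x : 0 < s < 1 -> itgoc a b (fun y => ker (x * y) * dquot s y).
Proof.
move=> s01; apply: (@itgoc_bounded _ _ _ (L / (1 - s))).
  by apply: measurable_funM; [exact: measurable_ker_scale|exact: measurable_dquot].
move=> y _; rewrite normrM; apply: le_trans (dquot_bnd y s01).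
by rewrite ler_piMl// (le_trans (ker_bnd _))//; lra.
Qed.

(** In the term with [f (s * y)] the kernel is [ker (x * (s * y))], so the substitution [u = s * y]
    applies. The endpoint [y0] stays free because [dquot_le_log] needs a short interval at 0. *)
Lemma intoc_ker_dquot s x y0 : 0 < s < 1 ->
  (1 - s) * intoc 0 y0 (fun y => ker (s * x * y) * dquot s y) =
  intoc 0 y0 (fun y => (ker (s * x * y) - ker (x * y)) * f y) +
  intoc 0 y0 (fun y => ker (x * y) * f y) -
  s^-1 * intoc 0 (s * y0) (fun u => ker (x * u) * f u).
Proof.
move=> s01; have /andP[s0 s1] := s01; have s'0 : 1 - s != 0 by rewrite gt_eqF//; lra.
rewrite -intocZ; last exact: itgoc_ker_dquot.
pose h u := ker (x * u) * f u.
have Is : itgoc 0 y0 (fun y => h (s * y)).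
  apply: itgoc_scale => //; first exact: measurable_kerf.
  exact: itgoc_kerf.
have E := @intoc_scale _ s 0 y0 h s0 (measurable_kerf x) (itgoc_kerf _ _ x).
rewrite mulr0 in E; rewrite -E -intocD; last 2 first.
- under eq_fun do rewrite mulrBl.
  by apply: itgocB; exact: itgoc_kerf.
- exact: itgoc_kerf.
rewrite -intocB//; last first.
  apply: itgocD; last exact: itgoc_kerf.
  under eq_fun do rewrite mulrBl.
  by apply: itgocB; exact: itgoc_kerf.
apply: eq_intoc => y _; rewrite /h /dquot.
have -> : x * (s * y) = s * x * y by ring.
by field.
Qed.

(** Take [y0 = 1] above and express [f x] and [f (s * x)] by the eigenvalue equation. The integral
    over []s, 1]] is left over because the dilated domain stops at [s]. *)
Lemma dquotE s x : 0 < s < 1 -> 0 < x <= 1 ->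
  dquot s x = - (f x / s) - lam * intoc 0 1 (fun y => ker (s * x * y) * dquot s y)
    + lam / (s * (1 - s)) * intoc s 1 (fun u => ker (x * u) * f u).
Proof.
move=> s01 x01; have /andP[s0 s1] := s01; have s'0 : 1 - s != 0 by rewrite gt_eqF//; lra.
have /andP[x0 x1] := x01; have s00 : s != 0 by rewrite gt_eqF.
have := intoc_ker_dquot x 1 s01; rewrite mulr1.
have -> : intoc 0 1 (fun y => (ker (s * x * y) - ker (x * y)) * f y) =
  intoc 0 1 (fun y => ker (s * x * y) * f y) - intoc 0 1 (fun y => ker (x * y) * f y).
  by rewrite -intocB//; apply: eq_intoc => y _; rewrite mulrBl.
rewrite subrK => E.
have E1 := fE x01; rewrite (intoc_split (ltW s0) (ltW s1) (itgoc_kerf _ _ _)) in E1.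
have sx01 : 0 < s * x <= 1 by rewrite mulr_gt0// mulr_ile1// ltW.
have E2 := fE sx01.
rewrite /dquot {1}E2 {1 2}E1.
set I1 := intoc 0 1 (fun y => ker (s * x * y) * f y) in E *.
set I2 := intoc 0 s _ in E *; set I3 := intoc s 1 _.
set I4 := intoc 0 1 _ in E *.
have -> : I4 = (1 - s)^-1 * (I1 - s^-1 * I2) by rewrite -E mulKf.
by field; rewrite s00 s'0.
Qed.


Let A := 10 * L ^+ 3.
Let A0 : 0 < A. Proof. by rewrite mulr_gt0// exprn_gt0. Qed.

Let sqrtV t : Num.sqrt t / t = (Num.sqrt t)^-1.
Proof.
have [t0|t0] := leP t 0; first by rewrite ler0_sqrtr// mul0r invr0.
have s0 : 0 < Num.sqrt t by rewrite sqrtr_gt0.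
move: (sqr_sqrtr (ltW t0)) s0; move: (Num.sqrt t) => q <- q0.
by field; rewrite gt_eqF.
Qed.

Let sqrt_div s u : 0 < s < 1 -> Num.sqrt (u / s) <= Num.sqrt u / s.
Proof.
move=> /andP[s0 s1].
have [u0|u0] := leP u 0.
  by rewrite ler0_sqrtr ?divr_ge0 ?sqrtr_ge0 ?(ltW s0)// mulr_le0_ge0// invr_ge0 ltW.
rewrite sqrtrM ?(ltW u0)// ler_wpM2l ?sqrtr_ge0//.
have s'1 : 1 <= s^-1 by rewrite invf_ge1// ltW.
have s'0 : 0 <= s^-1 by exact: le_trans s'1.
have : Num.sqrt s^-1 <= Num.sqrt (s^-1 ^+ 2).
  by apply: ler_wsqrtr; rewrite expr2 ler_peMr.
by rewrite sqrtr_sqr ger0_norm.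
Qed.

Let itgoc_sqrtV y0 : 0 <= y0 -> itgoc 0 y0 (fun y => A * Num.sqrt y / y) /\
  intoc 0 y0 (fun y => A * Num.sqrt y / y) <= 2 * A * Num.sqrt y0.
Proof.
move=> y00; have [I1 I2] := itgoc_int_isqrt y00.
have -> : (fun y => A * Num.sqrt y / y) = (fun y => A * (Num.sqrt y)^-1).
  by apply/funext => y; rewrite -mulrA sqrtV.
split; first exact: itgocZ.
have -> : 2 * A * Num.sqrt y0 = A * (2 * Num.sqrt y0) by ring.
by rewrite intocZ// ler_pM2l.
Qed.

Lemma dquot_le_inv s x : 2^-1 <= s < 1 -> 0 < x <= 1 ->
  `|dquot s x| <= 440 * L ^+ 2 * l / x.
Proof.
move=> s21 x01; have /andP[s2 s1] := s21; have /andP[x0 x1] := x01.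
have s0 : 0 < s by apply: lt_le_trans s2; rewrite invr_gt0.
have s'0 : 0 < 1 - s by lra.
(* The constant bound avoids a loss of powers of [L] for larger [y]; the square root makes [b y / y]
   integrable at 0. *)
pose b y := Num.min L (A * Num.sqrt y).
have b0 y : 0 <= b y by rewrite le_min (ltW L0) mulr_ge0 ?sqrtr_ge0// ltW.
have mb : measurable_fun setT b.
  by apply: measurable_minr => //; apply: measurable_funM => //; exact: measurable_sqrtr.
have mby : measurable_fun setT (fun y => b y / y).
  by apply: measurable_funM => //; exact: measurable_inv.
have bs u : 0 < u -> b (u / s) <= b u / s.
  move=> u0; rewrite ler_pdivlMr// le_min; apply/andP; split.
    apply: le_trans (_ : b (u / s) * 1 <= _); first by rewrite ler_wpM2l// ltW.
    by rewrite mulr1 ge_min lexx.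
  rewrite -ler_pdivlMr//; apply: le_trans (_ : A * Num.sqrt (u / s) <= _).
    by rewrite ge_min lexx orbT.
  by rewrite -[leRHS]mulrA ler_pM2l//; apply: sqrt_div; rewrite s0.
have fle y : 0 < y <= 1 -> `|f y| <= b y.
  move=> y01; rewrite le_min eigen_le_sqrt// andbT.
  by apply: le_trans (fb y) _; have := L0; lra.
have [I1 _] := itgoc_sqrtV ler01.
have b_le y : 0 < y -> `|b y / y| <= A * Num.sqrt y / y.
  move=> y0; rewrite ger0_norm ?divr_ge0 ?(ltW y0)//.
  by rewrite ler_pM2r ?invr_gt0// ge_min lexx orbT.
have Ib : itgoc 0 1 (fun y => b y / y).
  by apply: itgoc_le I1 => // y /andP[y0 _]; exact: b_le.
have IB : intoc 0 1 (fun y => b y / y) <= 44 * L * l.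
  (* Up to a constant this is where the two bounds cross. Below it the integral is at most [20 L],
     above it [4 L l]; with [l >= 1/2] the sum is at most [44 L l]. *)
  pose y1 := L ^- 4.
  have y10 : 0 < y1 by rewrite invr_gt0 exprn_gt0.
  have L1 : 1 <= L by have := L2; lra.
  have y11 : y1 <= 1 by rewrite invf_le1 ?exprn_gt0// exprn_ege1.
  rewrite (intoc_split (ltW y10) y11 Ib).
  have [J1 J2] := itgoc_sqrtV (ltW y10).
  have h1 : intoc 0 y1 (fun y => b y / y) <= 20 * L.
    apply: le_trans (_ : 2 * A * Num.sqrt y1 <= _).
      apply: le_trans J2; apply: le_intoc => //; first by apply: itgoc_sub Ib.
      by move=> y /andP[y0 _]; apply: le_trans (b_le _ y0); exact: ler_norm.
    have -> : y1 = (L ^- 2) ^+ 2 by rewrite /y1 exprVn -exprM.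
    rewrite sqrtr_sqr ger0_norm ?invr_ge0 ?exprn_ge0//.
    rewrite le_eqVlt; apply/orP; left; apply/eqP; rewrite /A; field.
    by rewrite gt_eqF.
  have h2 : intoc y1 1 (fun y => b y / y) <= 4 * L * l.
    have IV : itgoc y1 1 (fun w => w^-1) by exact: itgoc_inv.
    apply: le_trans (_ : intoc y1 1 (fun y => L * y^-1) <= _).
      apply: le_intoc; [by apply: itgoc_sub Ib => //; exact: ltW|exact: itgocZ|].
      move=> y /andP[y0 _]; rewrite ler_wpM2r ?ge_min ?lexx//.
      by rewrite invr_ge0 ltW// (lt_trans y10).
    rewrite intocZ// intoc_inv// ln1 sub0r -lnV ?posrE// invrK lnXn//.
    by rewrite -mulr_natl; lra.
  have := L0; have := l2; nra.
have := intoc_ker_diff s21 x0 ler01 mf mb b0 bs fle Ib.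
have -> : intoc 0 1 (fun y => (ker (s * x * y) - ker (x * y)) * f y) =
  intoc 0 1 (fun y => ker (s * x * y) * f y) - intoc 0 1 (fun y => ker (x * y) * f y).
  by rewrite -intocB//; apply: eq_intoc => y _; rewrite mulrBl.
move=> h.
have sx01 : 0 < s * x <= 1 by rewrite mulr_gt0// mulr_ile1// ltW.
set D := intoc 0 1 _ - intoc 0 1 _ in h.
have -> : dquot s x = - (lam * (D / (1 - s))).
  by rewrite /dquot {1}(fE x01) {1}(fE sx01) /D; ring.
rewrite normrN normrM [`|D / _|]normrM normfV [`|1 - s|]gtr0_norm//.
have -> : 440 * L ^+ 2 * l / x = L * (10 * (1 - s) / x * (44 * L * l) / (1 - s)).
  by field; rewrite !gt_eqF.
rewrite ler_pM2l// ler_pM2r ?invr_gt0//; apply: le_trans h _.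
by rewrite ler_wpM2l// divr_ge0 ?mulr_ge0// ltW.
Qed.

Let mean_term_bnd s x : 2^-1 <= s < 1 ->
  `|lam / (s * (1 - s)) * intoc s 1 (fun u => ker (x * u) * f u)| <= L ^+ 2 / 2.
Proof.
move=> /andP[s2 s1]; have s0 : 0 < s by apply: lt_le_trans s2; rewrite invr_gt0.
have s'0 : 0 < 1 - s by lra.
have h := @intoc_norm_bnd _ s 1 (L / 4) _ (measurable_kerf x) (ltW s1) (fun t _ => kerf_bnd x t).
rewrite normrM [`|lam / _|]normrM normfV [`|s * _|]gtr0_norm ?mulr_gt0//.
apply: le_trans (ler_wpM2l _ h) _.
  by rewrite divr_ge0// mulr_ge0 ?(ltW s0) ?(ltW s'0).
have -> : L / (s * (1 - s)) * (L / 4 * (1 - s)) = L ^+ 2 / 4 * s^-1.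
  by field; rewrite !gt_eqF.
have -> : L ^+ 2 / 2 = L ^+ 2 / 4 * 2 by field.
rewrite ler_wpM2l ?divr_ge0 ?exprn_ge0//.
by rewrite -[2]invrK lef_pV2 ?posrE ?invr_gt0.
Qed.

Let divs_bnd s y : 2^-1 <= s < 1 -> `|f y / s| <= L.
Proof.
move=> /andP[s2 s1]; have s0 : 0 < s by apply: lt_le_trans s2; rewrite invr_gt0.
rewrite normrM normfV (gtr0_norm s0) ler_pdivrMr//.
apply: le_trans (fb y) _; by rewrite ler_pM2l.
Qed.

Lemma dquot_le s x : 2^-1 <= s < 1 -> 0 < x <= 1 -> `|dquot s x| <=
  L + L ^+ 2 / 2 + `|lam * intoc 0 1 (fun y => ker (s * x * y) * dquot s y)|.
Proof.
move=> s21 x01; have /andP[s2 s1] := s21.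
have s0 : 0 < s by apply: lt_le_trans s2; rewrite invr_gt0.
have h1 := divs_bnd x s21; have h2 := mean_term_bnd x s21.
rewrite {1}dquotE ?s0//; apply: le_trans (ler_normD _ _) _.
apply: le_trans (lerD (ler_normB _ _) h2) _; rewrite normrN.
by rewrite addrAC lerD2r lerD2r.
Qed.

Lemma dquot_le_log s x : 2^-1 <= s < 1 -> 0 < x <= 1 ->
  `|dquot s x| <= K * (L ^+ 3 * (l * (l + ln x^-1))).
Proof.
move=> s21 x01; have /andP[s2 s1] := s21; have /andP[x0 x1] := x01.
have s0 : 0 < s by apply: lt_le_trans s2; rewrite invr_gt0.
have s01 : 0 < s < 1 by rewrite s0.
have s'0 : 0 < 1 - s by lra.
have L1 : 1 <= L by have := L2; lra.
apply: le_trans (dquot_le s21 x01) _; rewrite normrM.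
(* Below [y0] the square-root weight contributes a factor [sqrt y0 = x / L], which cancels the [1/x]
   of [intoc_ker_diff]; above [y0] the bound in [1/y] costs only a logarithm. *)
pose y0 := (x / L) ^+ 2.
have xL0 : 0 < x / L by rewrite divr_gt0.
have y00 : 0 < y0 by rewrite exprn_gt0.
have y01 : y0 <= 1 by rewrite expr_le1 ?(ltW xL0)// ler_pdivrMr// mul1r (le_trans x1).
have sy0 : 0 <= s * y0 by rewrite mulr_ge0 ?ltW.
have sy1 : s * y0 <= y0 by rewrite ler_piMl// ltW.
have x'1 : 0 <= ln x^-1 by exact: lnV_ge0.
rewrite (intoc_split (ltW y00) y01 (itgoc_ker_dquot _ _ _ s01)).
have h1 : `|intoc y0 1 (fun y => ker (s * x * y) * dquot s y)| <=
    440 * L ^+ 2 * l * (l + ln x^-1).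
  have IV : itgoc y0 1 (fun w => w^-1) by exact: itgoc_inv.
  apply: le_trans (_ : intoc y0 1 (fun y => 220 * L ^+ 2 * l * y^-1) <= _).
    apply: intoc_norm_le.
    - by apply: measurable_funM; [exact: measurable_ker_scale|exact: measurable_dquot].
    - exact: itgocZ.
    - move=> y /andP[yy y1]; have y'0 : 0 < y by exact: lt_trans yy.
      have hy : 0 < y <= 1 by rewrite y'0.
      rewrite normrM; apply: le_trans (ler_pM _ _ (ker_bnd _) (dquot_le_inv s21 hy)) _ => //.
      by rewrite le_eqVlt; apply/orP; left; apply/eqP; field; rewrite gt_eqF.
  rewrite intocZ// intoc_inv// ln1 sub0r /y0 lnXn// ln_div ?posrE// lnV ?posrE// -mulr_natl.
  by rewrite le_eqVlt; apply/orP; left; apply/eqP; ring.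
(* Near 0 no pointwise bound on the quotient is used; the dilation identity moves the difference
   onto the kernel. *)
have h2 : `|intoc 0 y0 (fun y => ker (s * x * y) * dquot s y)| <= 200 * L ^+ 2 + L.
  have [I1 I2] := itgoc_sqrtV (ltW y00).
  have mA : measurable_fun setT (fun y => A * Num.sqrt y).
    by apply: measurable_funM => //; exact: measurable_sqrtr.
  have A0' y : 0 <= A * Num.sqrt y by rewrite mulr_ge0 ?sqrtr_ge0 ?(ltW A0).
  have As u : 0 < u -> A * Num.sqrt (u / s) <= A * Num.sqrt u / s.
    by move=> u0; rewrite -[leRHS]mulrA ler_pM2l//; apply: sqrt_div; rewrite s0.
  have fle y : 0 < y <= y0 -> `|f y| <= A * Num.sqrt y.
    by move=> /andP[u0 u1]; apply: eigen_le_sqrt; rewrite u0 (le_trans u1).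
  have hJ := intoc_ker_diff s21 x0 (ltW y00) mf mA A0' As fle I1.
  have hJ' : 10 * (1 - s) / x * intoc 0 y0 (fun y => A * Num.sqrt y / y) <=
      200 * L ^+ 2 * (1 - s).
    apply: le_trans (ler_wpM2l _ I2) _; first by rewrite divr_ge0 ?mulr_ge0 ?ltW.
    rewrite /y0 sqrtr_sqr ger0_norm ?(ltW xL0)// le_eqVlt; apply/orP; left; apply/eqP.
    by rewrite /A; field; rewrite !gt_eqF.
  rewrite -(ler_pM2l s'0) -[1 - s in leLHS]gtr0_norm// -normrM intoc_ker_dquot//.
  rewrite -addrA; apply: le_trans (ler_normD _ _) _.
  rewrite mulrDr; apply: lerD; first by rewrite [leRHS]mulrC; exact: le_trans hJ hJ'.
  rewrite (intoc_split sy0 sy1 (itgoc_kerf _ _ _)).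
  have k1 := @intoc_norm_bnd _ 0 (s * y0) (L / 4) _ (measurable_kerf x) sy0 (fun t _ => kerf_bnd x t).
  have k2 := @intoc_norm_bnd _ (s * y0) y0 (L / 4) _ (measurable_kerf x) sy1 (fun t _ => kerf_bnd x t).
  set J1 := intoc 0 _ _ in k1 *; set J2 := intoc _ y0 _ in k2 *.
  (* Both remaining terms carry a factor [1 - s]: [J2] through the length of its interval, [J1]
     through its coefficient. *)
  have -> : J1 + J2 - s^-1 * J1 = J2 - (s^-1 - 1) * J1 by ring.
  apply: le_trans (ler_normB _ _) _.
  have s'1 : 0 <= s^-1 - 1 by rewrite subr_ge0 invf_ge1// ltW.
  rewrite normrM (ger0_norm s'1).
  have k3 : (s^-1 - 1) * `|J1| <= (s^-1 - 1) * (L / 4 * (s * y0 - 0)) by rewrite ler_wpM2l.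
  have k4 : (s^-1 - 1) * (L / 4 * (s * y0 - 0)) = (1 - s) * (L / 4 * y0).
    by field; rewrite gt_eqF.
  have k5 : (1 - s) * (L / 4 * y0) <= (1 - s) * (L / 4).
    by rewrite ler_pM2l// ler_piMr// divr_ge0// ltW.
  have L0' := L0; nra.
have h3 : L * `|intoc 0 y0 (fun y => ker (s * x * y) * dquot s y) +
      intoc y0 1 (fun y => ker (s * x * y) * dquot s y)| <=
   L * (200 * L ^+ 2 + L + 440 * L ^+ 2 * l * (l + ln x^-1)).
  by rewrite ler_wpM2l//; apply: le_trans (ler_normD _ _) _; exact: lerD.
apply: le_trans (lerD (lexx _) h3) _.
have l2' := l2; have L2' := L2.
have e1 := L_le_cube; have e2 := sqr_le_cube.
have e3 : 4^-1 <= l * (l + ln x^-1) by nra.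
have e4 : 0 <= L ^+ 3 by rewrite exprn_ge0.
have e5 : L ^+ 3 * 4^-1 <= L ^+ 3 * (l * (l + ln x^-1)) by rewrite ler_wpM2l.
(* The terms without logarithm add up to at most [201 L^3], and [L^3 <= 4 X] for the [X] set below.
   The total is at most [1244 X], within the constant 1300. *)
rewrite dquot_cstE.
have -> : L * (200 * L ^+ 2 + L + 440 * L ^+ 2 * l * (l + ln x^-1)) =
  200 * L ^+ 3 + L ^+ 2 + 440 * (L ^+ 3 * (l * (l + ln x^-1))) by ring.
set X := L ^+ 3 * (l * (l + ln x^-1)) in e5 *.
move: e1 e2 e5; move: X (L ^+ 3) (L ^+ 2) => X Y Z *; lra.
Qed.

(** [dquotE] is inserted under the integral sign, and Fubini turns each composition of two kernels
    into [ker2]. *)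
Lemma ker_dquotE s x : 0 < s < 1 -> 0 < x <= 1 ->
  lam * intoc 0 1 (fun y => ker (s * x * y) * dquot s y) =
  - (f (s * x) / s) - lam ^+ 2 * intoc 0 1 (fun w => ker2 (s * x) (s * w) * dquot s w)
  + lam ^+ 2 / (s * (1 - s)) * intoc s 1 (fun u => ker2 (s * x) (1 * u) * f u).
Proof.
move=> s01 x01; have /andP[s0 s1] := s01; have /andP[x0 x1] := x01.
have s'0 : 0 < 1 - s by lra.
have sx01 : 0 < s * x <= 1 by rewrite mulr_gt0// mulr_ile1// ltW.
set z := s * x in sx01 *; set c := lam / (s * (1 - s)).
have dM w : 0 < w <= 1 -> `|dquot s w| <= L / (1 - s) by move=> _; exact: dquot_bnd.
have fM w : s < w <= 1 -> `|f w| <= L / 2 by move=> _; exact: fb.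
have E1 := intoc_ker_int z s (measurable_dquot s) dM.
have I1 := itgoc_ker_int z s (measurable_dquot s) dM.
have E2 := intoc_ker_int z 1 mf fM.
have I2 := itgoc_ker_int z 1 mf fM.
rewrite -E1 -E2.
set G1 := (fun y => ker (z * y) * intoc 0 1 _) in I1 *.
set G2 := (fun y => ker (z * y) * intoc s 1 _) in I2 *.
have -> : intoc 0 1 (fun y => ker (z * y) * dquot s y) =
    intoc 0 1 (fun y => (- s^-1 * (ker (z * y) * f y) - lam * G1 y) + c * G2 y).
  apply: eq_intoc => y y01; rewrite dquotE// /G1 /G2.
  have -> : intoc 0 1 (fun w => ker (y * (s * w)) * dquot s w) =
            intoc 0 1 (fun w => ker (s * y * w) * dquot s w).
    by apply: eq_intoc => w _; congr (ker _ * _); ring.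
  have -> : intoc s 1 (fun w => ker (y * (1 * w)) * f w) =
            intoc s 1 (fun w => ker (y * w) * f w).
    by apply: eq_intoc => w _; rewrite mul1r.
  rewrite -/c; ring.
rewrite intocD; [|by apply: itgocB; apply: itgocZ|exact: itgocZ].
rewrite intocB; [|exact: itgocZ|exact: itgocZ].
rewrite !intocZ// (fE sx01) /c.
by field; rewrite !gt_eqF.
Qed.

Let second_term_bnd s x : 2^-1 <= s < 1 -> 0 < x <= 1 ->
  `|lam ^+ 2 / (s * (1 - s)) * intoc s 1 (fun u => ker2 (s * x) (1 * u) * f u)|
    <= 10 * L ^+ 3 * x.
Proof.
move=> s21 x01; have /andP[s2 s1] := s21; have /andP[x0 x1] := x01.
have s0 : 0 < s by apply: lt_le_trans s2; rewrite invr_gt0.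
have s'0 : 0 < 1 - s by lra.
have sx01 : 0 < s * x <= 1 by rewrite mulr_gt0// mulr_ile1// ltW.
have fM w : 0 < w <= 1 -> `|f w| <= L / 2 by move=> _; exact: fb.
have h : `|intoc s 1 (fun u => ker2 (s * x) (1 * u) * f u)| <= 10 * x * (L / 2) * (1 - s).
  rewrite -intoc_cst ?(ltW s1)//; apply: intoc_norm_le_itg; [|exact: itgoc_cst|].
    by apply: itgoc_sub (itgoc_ker2f (s * x) 1 mf fM) => //; exact: ltW.
  move=> u /andP[su u1]; have u0 : 0 < u by exact: lt_trans su.
  rewrite mul1r normrM; apply: ler_pM => //.
  apply: le_trans (ker2_le sx01 _) _; first by rewrite u0.
  rewrite ler_pdivrMr// -!mulrA ler_pM2l// mulrC ler_pM2l//; exact: ltW.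
rewrite normrM [`|lam ^+ 2 / _|]normrM normfV normrX [`|s * _|]gtr0_norm ?mulr_gt0//.
apply: le_trans (ler_wpM2l _ h) _.
  by rewrite divr_ge0 ?exprn_ge0// mulr_ge0 ?(ltW s0) ?(ltW s'0).
have -> : L ^+ 2 / (s * (1 - s)) * (10 * x * (L / 2) * (1 - s)) = 5 * L ^+ 3 * x * s^-1.
  by field; rewrite !gt_eqF.
have -> : 10 * L ^+ 3 * x = 5 * L ^+ 3 * x * 2 by ring.
rewrite ler_wpM2l ?mulr_ge0 ?exprn_ge0 ?(ltW x0)//.
by rewrite -[2]invrK lef_pV2 ?posrE ?invr_gt0.
Qed.

(** The majorant [q] is arbitrary since two are needed: one from the logarithmic bound on the
    quotient, then one from the uniform bound. *)
Lemma ker_dquot_le s x (q : R -> R) B : 2^-1 <= s < 1 -> 0 < x <= 1 ->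
  (forall w, 0 < w <= 1 -> Num.min 4^-1 (10 * x / w) * `|dquot s w| <= q w) ->
  itgoc 0 1 q -> intoc 0 1 q <= B ->
  `|lam * intoc 0 1 (fun y => ker (s * x * y) * dquot s y)| <=
  `|f (s * x) / s| + L ^+ 2 * B + 10 * L ^+ 3 * x.
Proof.
move=> s21 x01 hq Iq qB; have /andP[s2 s1] := s21.
have s0 : 0 < s by apply: lt_le_trans s2; rewrite invr_gt0.
have s01 : 0 < s < 1 by rewrite s0.
have dM w : 0 < w <= 1 -> `|dquot s w| <= L / (1 - s) by move=> _; exact: dquot_bnd.
rewrite ker_dquotE//; apply: le_trans (ler_normD _ _) _.
apply: lerD; last exact: second_term_bnd.
apply: le_trans (ler_normB _ _) _; rewrite normrN lerD2l normrM normrX.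
rewrite ler_wpM2l ?exprn_ge0//; apply: le_trans qB.
apply: intoc_norm_le_itg => //; first exact: itgoc_ker2f (measurable_dquot s) dM.
move=> w w01; rewrite normrM; apply: le_trans (hq _ w01).
by rewrite ler_wpM2r//; apply: ker2_min => //; rewrite s0 ltW.
Qed.

(** The fourth root splits the singularity at 0 in two: [min_le_rt] and [log_le_rt] each cost one
    factor [1 / rt w], and their product [1 / sqrt w] is still integrable. *)
Let rt x := Num.sqrt (Num.sqrt x).

Let rt_gt0 x : 0 < x -> 0 < rt x.
Proof. by move=> x0; rewrite !sqrtr_gt0. Qed.

Let rt_le1 x : x <= 1 -> rt x <= 1.
Proof. by move=> x1; do 2 apply: sqrtr_le1. Qed.

Let rt2 x : 0 < x -> rt x ^+ 2 = Num.sqrt x.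
Proof. by move=> x0; rewrite sqr_sqrtr ?sqrtr_ge0. Qed.

Let rt4 x : 0 < x -> rt x ^+ 4 = x.
Proof. by move=> x0; rewrite (exprM _ 2 2) rt2// sqr_sqrtr ?ltW. Qed.

Let min_le_rt x w : 0 < x -> 0 < w ->
  Num.min 4^-1 (10 * x / w) <= 10 * (rt x / rt w).
Proof.
move=> x0 w0; have a0 := rt_gt0 x0; have b0 := rt_gt0 w0.
have [xw|wx] := leP (rt x) (rt w).
  apply: le_trans (_ : 10 * x / w <= _); first by rewrite ge_min lexx orbT.
  rewrite -mulrA ler_pM2l// -{1}(rt4 x0) -{1}(rt4 w0) -expr_div_n.
  have t0 : 0 <= rt x / rt w by rewrite divr_ge0 ?ltW.
  have t1 : rt x / rt w <= 1 by rewrite ler_pdivrMr// mul1r.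
  by rewrite exprS ler_piMr// expr_le1.
apply: le_trans (_ : 4^-1 <= _); first by rewrite ge_min lexx.
have : 1 <= rt x / rt w by rewrite ler_pdivlMr// mul1r ltW.
lra.
Qed.

Let log_le_rt w : 0 < w <= 1 -> l + ln w^-1 <= 9 * l / rt w.
Proof.
move=> /andP[w0 w1]; have b0 := rt_gt0 w0; have b1 := rt_le1 w1.
have h : ln w^-1 <= 4 * (rt w)^-1 - 4.
  have sw : 0 < Num.sqrt w by rewrite sqrtr_gt0.
  have := ln_inv_le_isqrt sw; rewrite !lnV ?posrE// (ln_sqrt w0) -/(rt w); lra.
have : 1 <= (rt w)^-1 by rewrite invf_ge1.
have := l2; move: (rt w)^-1 h => r *; nra.
Qed.

Lemma dquot_le_unif s x : 2^-1 <= s < 1 -> 0 < x <= 1 ->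
  `|dquot s x| <= 181 * (K * (L ^+ 3 * l ^+ 2)).
Proof.
move=> s21 x01; have /andP[x0 x1] := x01.
have l2' := l2; have L2' := L2; have L0' := L0.
have l0 : 0 <= l by lra.
have K1 := @dquot_cst_ge R; have K0 : 0 <= K by lra.
have e0 : 0 <= L ^+ 3 by rewrite exprn_ge0.
have e4 : 4^-1 <= l ^+ 2 by nra.
have e5 : L ^+ 3 * 4^-1 <= L ^+ 3 * l ^+ 2 by rewrite ler_wpM2l.
have X0 : 0 <= L ^+ 3 * l ^+ 2 by rewrite mulr_ge0// exprn_ge0.
(* In the case of small [x] the lower-order terms total at most [10.75 L^3], hence at most
   [43 L^3 l^2] because [l^2 >= 1/4]. *)
have e6 : 43 * (L ^+ 3 * l ^+ 2) <= K * (L ^+ 3 * l ^+ 2) by rewrite ler_wpM2r.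
(* For [x > L^-8] the logarithm is at most [8 l] and [dquot_le_log] suffices. For smaller [x], one
   substitution gains a factor [rt x <= L^-2], which cancels the [lam^2] it introduces. *)
have [xs|xb] := leP (rt x) (L ^- 2); last first.
  apply: le_trans (dquot_le_log s21 x01) _.
  have h : ln x^-1 <= 8 * l.
    have : ln (L ^- 2) <= ln (rt x) by rewrite ler_ln ?posrE ?invr_gt0 ?exprn_gt0 ?rt_gt0// ltW.
    rewrite !lnV ?posrE ?exprn_gt0// lnXn// -mulr_natl (ln_sqrt x0) (ln_sqrt (x := Num.sqrt x)) ?sqrtr_gt0//.
    rewrite -/(rt x); lra.
  have h2 : l * (l + ln x^-1) <= 9 * l ^+ 2.
    have -> : 9 * l ^+ 2 = l * (9 * l) by ring.
    by rewrite ler_wpM2l//; lra.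
  have h3 : K * (L ^+ 3 * (l * (l + ln x^-1))) <= K * (L ^+ 3 * (9 * l ^+ 2)).
    by rewrite ler_wpM2l// ler_wpM2l.
  have E : K * (L ^+ 3 * (9 * l ^+ 2)) = 9 * (K * (L ^+ 3 * l ^+ 2)) by ring.
  rewrite E in h3; apply: le_trans h3 _.
  by move: e6 X0; move: (K * (L ^+ 3 * l ^+ 2)) (L ^+ 3 * l ^+ 2) => *; lra.
(* The factor 90 is 10 from [min_le_rt] times 9 from [log_le_rt]. Integrating [1 / sqrt w] doubles
   it to 180, and the remaining terms account for the last unit of 181. *)
pose c := 90 * (K * (L ^+ 3 * l ^+ 2)) * rt x.
have r0 := rt_gt0 x0.
have c0 : 0 <= c by rewrite /c; apply: mulr_ge0 (ltW r0); rewrite mulr_ge0// mulr_ge0.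
have [I1 I2] := @itgoc_int_isqrt R 1 ler01.
have hq w : 0 < w <= 1 ->
    Num.min 4^-1 (10 * x / w) * `|dquot s w| <= c * (Num.sqrt w)^-1.
  move=> w01; have /andP[w0 w1] := w01.
  apply: le_trans (_ : 10 * (rt x / rt w) * (K * (L ^+ 3 * (l * (9 * l / rt w)))) <= _).
    apply: ler_pM => //; last 2 first.
    - exact: min_le_rt.
    - apply: le_trans (dquot_le_log s21 w01) _.
      by rewrite ler_wpM2l// ler_wpM2l// ler_wpM2l// log_le_rt.
    - by rewrite le_min invr_ge0 divr_ge0 ?mulr_ge0 ?(ltW x0) ?(ltW w0)// ler0n.
  rewrite -(rt2 w0) /c le_eqVlt; apply/orP; left; apply/eqP.
  have : rt w != 0 by rewrite gt_eqF// rt_gt0.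
  move: (rt w) (rt x) K (L ^+ 3) => p q k Y p0; field; exact: p0.
have qB : intoc 0 1 (fun w => c * (Num.sqrt w)^-1) <= c * 2.
  by rewrite intocZ// ler_wpM2l//; move: I2; rewrite sqrtr1 mulr1.
have h := ker_dquot_le s21 x01 hq (itgocZ c I1) qB.
apply: le_trans (dquot_le s21 x01) _; apply: le_trans (lerD (lexx _) h) _.
have h1 := divs_bnd (s * x) s21.
have h2 : L ^+ 2 * (c * 2) <= 180 * (K * (L ^+ 3 * l ^+ 2)).
  have -> : L ^+ 2 * (c * 2) = 180 * (K * (L ^+ 3 * l ^+ 2)) * (rt x * L ^+ 2).
    by rewrite /c; ring.
  rewrite ler_piMr//; first by rewrite mulr_ge0// mulr_ge0.
  by rewrite -ler_pdivlMr ?exprn_gt0// mul1r.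
have h3 : 10 * L ^+ 3 * x <= 10 * L ^+ 3 by rewrite ler_piMr// mulr_ge0.
have e1 : L <= L ^+ 3 / 4 by exact: L_le_cube.
have e2 : L ^+ 2 <= L ^+ 3 / 2 by exact: sqr_le_cube.
move: h1 h2 h3 e1 e2 e5 e0 e6; move: (K * (L ^+ 3 * l ^+ 2)) (L ^+ 3 * l ^+ 2) => KX X.
move: (L ^+ 2 * (c * 2)) (10 * L ^+ 3 * x) `|f (s * x) / s| => U V W.
move: (L ^+ 3) (L ^+ 2) => Y Z *; lra.
Qed.

Lemma dquot_mean_le s x : 2^-1 <= s < 1 -> 0 < x <= 1 ->
  `|dquot s x - lam / (s * (1 - s)) * intoc s 1 (fun u => ker (x * u) * f u)| <=
  2000 * (K * (L ^+ 5 * l ^+ 2 * (x * (1 + ln x^-1)))).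
Proof.
move=> s21 x01; have /andP[x0 x1] := x01; have /andP[s2 s1] := s21.
have s0 : 0 < s by apply: lt_le_trans s2; rewrite invr_gt0.
have s01 : 0 < s < 1 by rewrite s0.
have l2' := l2; have L2' := L2; have L0' := L0.
have l0 : 0 <= l by lra.
have K1 := @dquot_cst_ge R; have K0 : 0 <= K by lra.
have x'0 : 0 <= ln x^-1 by exact: lnV_ge0.
pose X := x * (1 + ln x^-1).
have xX : x <= X by rewrite /X ler_peMr//; lra.
pose M := 181 * (K * (L ^+ 3 * l ^+ 2)).
have M0 : 0 <= M by rewrite /M mulr_ge0// mulr_ge0// mulr_ge0// exprn_ge0.
have [I1 I2] := intoc_minV x01.
have hq w : 0 < w <= 1 ->
    Num.min 4^-1 (10 * x / w) * `|dquot s w| <= M * Num.min 4^-1 (10 * x / w).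
  move=> w01; have /andP[w0 w1] := w01; rewrite mulrC ler_wpM2r ?dquot_le_unif//.
  by rewrite le_min invr_ge0 divr_ge0 ?mulr_ge0 ?(ltW x0) ?(ltW w0)// ler0n.
have qB : intoc 0 1 (fun w => M * Num.min 4^-1 (10 * x / w)) <= M * (10 * X).
  by rewrite intocZ// ler_wpM2l// /X mulrA.
have h := ker_dquot_le s21 x01 hq (itgocZ M I1) qB.
rewrite (dquotE s01 x01) addrK.
apply: le_trans (ler_normB _ _) _; rewrite normrN.
have s'2 : s^-1 <= 2 by rewrite -[2]invrK lef_pV2 ?posrE ?invr_gt0.
have s'0 : 0 < s^-1 by rewrite invr_gt0.
have h1 : `|f x / s| <= 10 * (L ^+ 3 * X).
  rewrite normrM normfV (gtr0_norm s0).
  have := eigen_le x01; rewrite -/X => hX.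
  apply: le_trans (ler_pM _ _ hX s'2) _ => //; first exact: ltW.
  by rewrite le_eqVlt; apply/orP; left; apply/eqP; ring.
have h2 : `|f (s * x) / s| <= 10 * (L ^+ 3 * X).
  have sx01 : 0 < s * x <= 1 by rewrite mulr_gt0// mulr_ile1// ltW.
  rewrite normrM normfV (gtr0_norm s0) ler_pdivrMr//.
  apply: le_trans (eigen_le sx01) _.
  (* Passing from [x] to [s * x] raises the logarithm by [ln (1/s) <= 1/s - 1 <= 1], which the
     factor 2 absorbs. *)
  have -> : 10 * (L ^+ 3 * X) * s = 5 * L ^+ 3 * (s * x * (2 * (1 + ln x^-1))).
    by rewrite /X; ring.
  rewrite ler_wpM2l ?mulr_ge0 ?exprn_ge0// ler_wpM2l ?mulr_ge0 ?(ltW s0) ?(ltW x0)//.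
  rewrite invfM lnM ?posrE ?invr_gt0//.
  have := ln_le_subr1 s'0; lra.
have e0 : 0 <= L ^+ 3 by rewrite exprn_ge0.
(* Since [L * l >= 1], the three terms of order [L^3] are dominated by the main one. The constants
   add up to [1810 + 30], below 2000. *)
have e1 : L ^+ 3 <= L ^+ 5 * l ^+ 2.
  have : 1 <= (L * l) ^+ 2 by rewrite exprn_ege1// Ll_ge1.
  have -> : L ^+ 5 * l ^+ 2 = L ^+ 3 * (L * l) ^+ 2 by ring.
  by move=> ?; rewrite ler_peMr.
have X0 : 0 <= X by apply: le_trans xX; exact: ltW.
have e2 : L ^+ 3 * X <= L ^+ 5 * l ^+ 2 * X by rewrite ler_wpM2r.
have e3 : 10 * L ^+ 3 * x <= 10 * (L ^+ 3 * X) by rewrite -mulrA ler_wpM2l// ler_wpM2l.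
have V0 : 0 <= L ^+ 5 * l ^+ 2 * X by apply: le_trans e2; rewrite mulr_ge0.
have e5 : L ^+ 5 * l ^+ 2 * X <= K * (L ^+ 5 * l ^+ 2 * X).
  by rewrite ler_peMl//; lra.
have e4 : L ^+ 2 * (M * (10 * X)) = 1810 * (K * (L ^+ 5 * l ^+ 2 * X)).
  by rewrite /M; ring.
rewrite e4 in h; apply: le_trans (lerD h1 h) _; rewrite -/X.
move: h2 e2 e3 e5 V0; move: `|f (s * x) / s| (K * (L ^+ 5 * l ^+ 2 * X)) => U KV.
move: (L ^+ 5 * l ^+ 2 * X) (L ^+ 3 * X) (10 * L ^+ 3 * x) => V W Y *; lra.
Qed.

End Eigenfunction.

(** * The limit of the difference quotients *)

Section Limit.
Context {R : realType}.
Implicit Types (s x u : R).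

(** Passing from [x] to [x * u] can only increase the reciprocal, and the floor is right-continuous.
    The case of an integer [1/x] therefore needs no separate treatment. *)
Lemma ker_floor_eq x u : 0 < x -> 0 < u <= 1 ->
  (x * u)^-1 < (Num.floor x^-1)%:~R + 1 -> ker (x * u) - ker x = x^-1 - (x * u)^-1.
Proof.
move=> x0 /andP[u0 u1] h; rewrite !kerE ?gt_eqF ?mulr_gt0//.
rewrite (@floor_def _ (x * u)^-1 (Num.floor x^-1)); first by ring.
rewrite intrD h andbT; apply: le_trans (floor_le _) _.
by rewrite lef_pV2 ?posrE ?mulr_gt0// ler_piMr// ltW.
Qed.

(** The integrand varies by [O(1 - s)] on []s, 1]]: the kernel because its floor is constant there,
    [f] by the Lipschitz bound at 1. The constants may depend on [x] and [lam], as they disappear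
    when [s] tends to 1. *)
Lemma mean_limit (f : R -> R) (lam x M : R) :
  measurable_fun setT f -> (forall t, `|f t| <= `|lam| / 2) -> 0 < x <= 1 ->
  (forall s, 2^-1 <= s < 1 -> `|f 1 - f s| <= M * (1 - s)) ->
  exists s0 C, [/\ s0 < 1, 0 <= C & forall s, 2^-1 <= s < 1 -> s0 < s ->
  `|lam / (s * (1 - s)) * intoc s 1 (fun u => ker (x * u) * f u) - lam * ker x * f 1|
    <= C * (1 - s)].
Proof.
move=> mf fb /andP[x0 x1] fM.
have M0 : 0 <= M.
  have := fM 2^-1; rewrite lexx invf_lt1 ?ltr1n// => /(_ isT) h.
  by have := le_trans (normr_ge0 _) h; rewrite pmulr_lge0//; lra.
pose n : R := (Num.floor x^-1)%:~R + 1.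
have xn : x^-1 < n by rewrite /n; have := floorD1_gt x^-1; rewrite intrD.
have n0 : 0 < n by apply: lt_trans xn; rewrite invr_gt0.
pose c := `|lam| / x + M.
have c0 : 0 <= c by rewrite addr_ge0// divr_ge0// ltW.
(* Beyond [1/(x n)] the reciprocal [1/(x u)] stays below [n]. In the second constant, [c] measures
   the variation of the integrand and [lam^2 / 2] pays for replacing [1/s] by 1. *)
exists (x * n)^-1, (2 * `|lam| * c + `|lam| ^+ 2 / 2); split.
- by rewrite invf_lt1 ?mulr_gt0// mulrC -ltr_pdivrMr// mul1r.
- by rewrite addr_ge0 ?divr_ge0 ?exprn_ge0// mulr_ge0// mulr_ge0.
move=> s s21 ns; have /andP[s2 s1] := s21.
have s0 : 0 < s by apply: lt_le_trans s2; rewrite invr_gt0.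
have s'0 : 0 < 1 - s by lra.
have sV : s^-1 - 1 <= 2 * (1 - s).
  have : s * s^-1 = 1 by rewrite mulfV// gt_eqF.
  move: (s^-1) => r ?; nra.
have sV2 : s^-1 <= 2 by rewrite -[2]invrK lef_pV2 ?posrE ?invr_gt0.
have sV0 : 0 < s^-1 by rewrite invr_gt0.
have sV1 : 0 <= s^-1 - 1 by rewrite subr_ge0 invf_ge1// ltW.
have mk : measurable_fun setT (fun u => ker (x * u) * f u).
  by apply: measurable_funM => //; exact: measurable_ker_scale.
have Ik : itgoc s 1 (fun u => ker (x * u) * f u).
  apply: (@itgoc_bounded _ _ _ (`|lam| / 2)) => // u _; rewrite normrM.
  apply: le_trans (fb u); rewrite ler_piMl//; apply: le_trans (ker_bnd _) _; lra.
have hD : `|intoc s 1 (fun u => ker (x * u) * f u - ker x * f 1)| <= c * (1 - s) * (1 - s).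
  apply: intoc_norm_bnd; [by apply: measurable_funB|exact: ltW|].
  move=> u /andP[su u1]; have u0 : 0 < u by exact: lt_trans su.
  have -> : ker (x * u) * f u - ker x * f 1 =
    (ker (x * u) - ker x) * f u + ker x * (f u - f 1) by ring.
  apply: le_trans (ler_normD _ _) _; rewrite !normrM.
  have k1 : `|ker (x * u) - ker x| <= 2 * (1 - s) / x.
    rewrite ker_floor_eq ?u0//; last first.
      rewrite -/n invf_plt ?posrE ?mulr_gt0// -ltr_pdivrMl//.
      by rewrite -invfM; exact: lt_trans su.
    have h : x^-1 <= (x * u)^-1 by rewrite lef_pV2 ?posrE ?mulr_gt0// ler_piMr// ltW.
    rewrite distrC ger0_norm ?subr_ge0// invfM.
    have : u^-1 <= s^-1 by rewrite lef_pV2 ?posrE// ltW.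
    move=> us; have -> : x^-1 / u - x^-1 = (u^-1 - 1) / x by ring.
    by rewrite ler_pM2r ?invr_gt0//; lra.
  have k2 : `|f u - f 1| <= M * (1 - s).
    rewrite distrC; case: (ltgtP u 1) u1 => // [u1 _|-> _]; last first.
      by rewrite subrr normr0 mulr_ge0// ltW.
    apply: le_trans (fM u _) _; first by rewrite u1 andbT (le_trans s2)// ltW.
    by rewrite ler_wpM2l//; lra.
  have k3 : `|ker (x * u) - ker x| * `|f u| <= 2 * (1 - s) / x * (`|lam| / 2).
    by apply: ler_pM.
  have k4 : `|ker x| * `|f u - f 1| <= 1 * (M * (1 - s)).
    apply: ler_pM => //; apply: le_trans (ker_bnd _) _; lra.
  apply: le_trans (lerD k3 k4) _; rewrite /c le_eqVlt; apply/orP; left; apply/eqP.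
  by field; rewrite gt_eqF.
rewrite intocB// in hD; last exact: itgoc_cst.
rewrite intoc_cst ?(ltW s1)// in hD.
set I := intoc s 1 _ in hD *.
have -> : lam / (s * (1 - s)) * I - lam * ker x * f 1 =
   lam * s^-1 * ((I - ker x * f 1 * (1 - s)) / (1 - s)) + lam * (s^-1 - 1) * (ker x * f 1).
  by field; rewrite !gt_eqF.
apply: le_trans (ler_normD _ _) _; rewrite [leRHS]mulrDl; apply: lerD.
  rewrite !normrM !normfV (gtr0_norm s0) (gtr0_norm s'0).
  have -> : 2 * `|lam| * c * (1 - s) = `|lam| * 2 * (c * (1 - s)) by ring.
  apply: ler_pM; rewrite ?mulr_ge0 ?invr_ge0 ?(ltW s0) ?(ltW s'0)//.
    by rewrite ler_wpM2l.
  by rewrite ler_pdivrMr.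
rewrite !normrM (ger0_norm sV1).
have -> : `|lam| ^+ 2 / 2 * (1 - s) = `|lam| * (2 * (1 - s)) * (2^-1 * (`|lam| / 2)) by field.
apply: ler_pM => //; rewrite ?mulr_ge0//.
  by rewrite ler_wpM2l.
by apply: ler_pM => //; exact: ker_bnd.
Qed.

End Limit.

(** * Normalised eigenfunctions and the passage to the derivative *)

Section EigenNormalised.
Context {R : realType} (p : R -> R) (lam : R).
Hypothesis eig : eigenfun p lam.
Hypothesis p1 : inner p p = 1.

(** The extension by zero is measurable and bounded on the whole line, whereas nothing is known
    about [p] outside the unit interval. *)
Let f : R -> R := p \_ (@I01 R).

Let fp t : 0 <= t <= 1 -> f t = p t.
Proof. by move=> t01; rewrite /f /patch mem_set//= /I01/= in_itv. Qed.

Let pE x : 0 <= x <= 1 ->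
  p x = lam * Rintegral (@Defs.mu R) (@I01 R) (fun y => Kern x y * p y).
Proof. by case: eig => _ [_ h] x01; apply: h; rewrite inE /I01/= in_itv. Qed.

Lemma measurable_eigen : measurable_fun setT f.
Proof.
have [[mp _] _] := eig; apply/(measurable_restrictT _ _).1; last exact: mp.
exact: measurable_itv.
Qed.

Let itgoc_sqr : itgoc 0 1 (fun t => f t ^+ 2).
Proof.
case: eig => -[mp ip] _.
have : itgoc 0 1 (fun t => p t ^+ 2).
  apply: integrableS ip => //; first exact: measurable_itv.
  by rewrite /I01; apply: subset_itv; rewrite bnd_simp.
apply: eq_integrable => // t; rewrite inE/= in_itv/= => /andP[t0 t1].
by rewrite fp// t1 ltW.
Qed.

Let intoc_sqr : intoc 0 1 (fun t => f t ^+ 2) = 1.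
Proof.
rewrite -intoc_closed// -[RHS]p1 /inner; apply: eq_Rintegral => t.
by rewrite inE/= in_itv/= => t01; rewrite fp// expr2.
Qed.

Let measurable_kerf (x : R) : measurable_fun setT (fun y => ker (x * y) * f y).
Proof.
by apply: measurable_funM; [exact: measurable_ker_scale|exact: measurable_eigen].
Qed.

Let Iamgm : itgoc 0 1 (fun t => 4^-1 + 4^-1 * f t ^+ 2).
Proof. by apply: itgocD; [exact: itgoc_cst|exact: itgocZ]. Qed.

(** The arithmetic-geometric mean inequality stands in for Cauchy-Schwarz. With [f] of norm 1 the
    right-hand side integrates to [1/2], so nothing is lost. *)
Let kerf_amgm (x t : R) : `|ker (x * t) * f t| <= 4^-1 + 4^-1 * f t ^+ 2.
Proof.
rewrite normrM; apply: le_trans (ler_wpM2r _ (ker_bnd _)) _ => //.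
rewrite -(real_normK (num_real (f t))).
have : 0 <= (`|f t| - 1) ^+ 2 by exact: sqr_ge0.
by move: `|f t| => q; nra.
Qed.

Let itgoc_kerf (x : R) : itgoc 0 1 (fun y => ker (x * y) * f y).
Proof.
by apply: itgoc_le Iamgm; [exact: measurable_kerf|move=> t _; exact: kerf_amgm].
Qed.

Lemma eigenE (x : R) : 0 < x <= 1 -> f x = lam * intoc 0 1 (fun y => ker (x * y) * f y).
Proof.
move=> /andP[x0 x1]; rewrite fp ?x1 ?ltW// pE ?x1 ?ltW//; congr (_ * _).
rewrite -intoc_closed//; apply: eq_Rintegral => t.
by rewrite inE /I01/= in_itv/= => t01; rewrite KernE fp.
Qed.

Lemma eigen_bnd (t : R) : `|f t| <= `|lam| / 2.
Proof.
have [t01|/negbTE nt] := boolP (0 <= t <= 1); last first.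
  by rewrite /f /patch memNset ?normr0 ?divr_ge0//= /I01/= in_itv/= nt.
have -> : f t = lam * intoc 0 1 (fun y => ker (t * y) * f y).
  rewrite fp// pE//; congr (_ * _).
  rewrite -intoc_closed//; apply: eq_Rintegral => y.
  by rewrite inE /I01/= in_itv/= => y01; rewrite KernE fp.
rewrite normrM ler_wpM2l//.
apply: le_trans (intoc_norm_le (measurable_kerf t) Iamgm (fun y _ => kerf_amgm t y)) _.
rewrite intocD; [|exact: itgoc_cst|exact: itgocZ].
rewrite intoc_cst// intocZ// intoc_sqr; lra.
Qed.

(** The sup bound [|lam| / 2] must be at least the norm of [f], which is 1. *)
Lemma eigenvalue_ge2 : 2 <= `|lam|.
Proof.
have h : 1 <= (`|lam| / 2) ^+ 2 * (1 - 0).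
  rewrite -intoc_cst// -[leLHS]intoc_sqr; apply: le_intoc => //; first exact: itgoc_cst.
  move=> t _; rewrite -(real_normK (num_real (f t))).
  by apply: lerXn2r; rewrite ?nnegrE ?divr_ge0// eigen_bnd.
rewrite leNgt; apply/negP => l2; have := normr_ge0 lam.
by move: `|lam| h l2 => q; nra.
Qed.

Lemma eigen_deriv_le x d : 0 < x -> x <= 1 -> deriv01 p x d ->
  `|x * d + lam * p 1 * B1 x^-1| <=
  2000 * (dquot_cst * (`|lam| ^+ 5 * ln `|lam| ^+ 2 * (x * (1 + ln x^-1)))).
Proof.
move=> x0 x1 dp; have x01 : 0 < x <= 1 by rewrite x0.
have mf := measurable_eigen; have fb := eigen_bnd; have L2 := eigenvalue_ge2.
have fE := eigenE.
set M := 181 * (dquot_cst * (`|lam| ^+ 3 * ln `|lam| ^+ 2)) : R.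
have fM s : 2^-1 <= s < 1 -> `|f 1 - f s| <= M * (1 - s).
  move=> s21; have /andP[s2 s1] := s21; have s'0 : 0 < 1 - s by lra.
  have h : 0 < (1 : R) <= 1 by rewrite ltr01 lexx.
  have := dquot_le_unif mf L2 fb fE s21 h.
  by rewrite /dquot mulr1 normrM normfV (gtr0_norm s'0) ler_pdivrMr.
have [s0 [C [s01 C0 hC]]] := mean_limit mf fb x01 fM.
apply/ler_addgt0Pr => e e0.
have e2 : 0 < e / 2 by lra.
have /cvgrPdist_lt/(_ _ e2) := dp.
rewrite near_withinE => /nbhs_ballP[r /= r0 hr].
(* Any [s] between [m] and 1 meets the conditions of the quotient bounds and of [mean_limit], has a
   step [(1 - s) x < r], and keeps [C (1 - s)] below [e / 2]. Using [C + 1] avoids division by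
   zero. *)
pose m := Num.max (Num.max 2^-1 s0) (Num.max (1 - r) (1 - e / (2 * (C + 1)))).
have m1 : m < 1.
  rewrite /m !gt_max s01 invf_lt1 ?ltr1n//=; apply/andP; split; first lra.
  by rewrite gtrBl divr_gt0// mulr_gt0//; lra.
pose s := (m + 1) / 2.
have ms : m < s by rewrite /s; lra.
have s1 : s < 1 by rewrite /s; lra.
have : m < s by []. rewrite {1}/m !gt_max => /andP[/andP[s2 s0s] /andP[sr se]].
have s21 : 2^-1 <= s < 1 by rewrite ltW.
have s'0 : 0 < 1 - s by lra.
have sp : 0 < s by apply: lt_trans s2; rewrite invr_gt0.
have sx : 0 <= s * x <= 1.
  rewrite mulr_ge0 ?(ltW sp) ?(ltW x0)//=.
  exact: mulr_ile1 (ltW sp) (ltW x0) (ltW s1) x1.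
have hq := dquot_mean_le mf L2 fb fE s21 x01.
have hm := hC s s21 s0s.
have hd : `|d - dquot f s x / x| < e / 2.
  have h0 : (s - 1) * x != 0 by apply: mulf_neq0; [rewrite lt_eqF// subr_lt0|rewrite gt_eqF].
  have := hr ((s - 1) * x).
  rewrite /ball/= sub0r normrN normrM (gtr0_norm x0) distrC (gtr0_norm s'0).
  have lr : (1 - s) * x < r by nra.
  move=> /(_ lr h0) /=.
  (* The derivative is probed from the left only, so the point stays in the unit interval even for
     [x = 1]. *)
  have -> : x + (s - 1) * x = s * x by ring.
  have I : s * x \in @I01 R by rewrite inE /I01/= in_itv.
  move=> /(_ I); rewrite /dquot !fp ?x1 ?(ltW x0)//.
  have -> : (p (s * x) - p x) / ((s - 1) * x) = (p x - p (s * x)) / (1 - s) / x.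
    have a1 : s - 1 != 0 by rewrite lt_eqF// subr_lt0.
    have a2 : 1 - s != 0 by rewrite gt_eqF.
    have a3 : x != 0 by rewrite gt_eqF.
    by field; rewrite ?a1 ?a2 ?a3.
  by [].
have f1 : f 1 = p 1 by rewrite fp// ler01 lexx.
have kx : B1 x^-1 = - ker x by rewrite /B1 /ker gt_eqF// opprB.
rewrite kx -f1.
set D := dquot f s x in hq hd; set J := _ / _ * _ in hq hm.
(* The first and last summands are the errors of the two limits, at most [e / 2] each; the middle
   one is bounded uniformly in [s] by [dquot_mean_le]. *)
have -> : x * d + lam * f 1 * - ker x =
   x * (d - D / x) + (D - J) + (J - lam * ker x * f 1).
  by field; rewrite gt_eqF.
apply: le_trans (ler_normD _ _) _; apply: le_trans (lerD (ler_normD _ _) (lexx _)) _.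
have h1 : `|x * (d - D / x)| <= e / 2.
  rewrite normrM (gtr0_norm x0); apply: le_trans (_ : 1 * `|d - D / x| <= _).
    by rewrite ler_wpM2r.
  by rewrite mul1r ltW.
have h2 : C * (1 - s) <= e / 2.
  have : 1 - s < e / (2 * (C + 1)) by lra.
  rewrite ltr_pdivlMr ?mulr_gt0//; last lra.
  by move=> ?; nra.
by move: h1 h2 hq hm; lra.
Qed.

End EigenNormalised.

Theorem theorem5p4 (R : realType) :
  exists C : R, 0 < C /\
  forall (phi : nat -> R -> R) (lam : nat -> R),
    eigen_system phi lam ->
    forall (j : nat) (x d : R),
      0 < x -> x <= 1 ->
      deriv01 (phi j) x d ->
      `| x * d + lam j * phi j 1 * B1 x^-1 |
        <= C * `|lam j| ^+ 5 * (ln `|lam j|) ^+ 2 * (1 + ln x^-1) * x.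
Proof.
exists (2000 * dquot_cst); split.
  apply: mulr_gt0; first by rewrite ltr0n.
  by apply: lt_le_trans (@dquot_cst_ge R); rewrite ltr0n.
move=> phi lam [eig orth _ _ _] j x d x0 x1 dp.
have [_ ej] := eig j; have oj := orth j j; rewrite eqxx in oj.
apply: le_trans (eigen_deriv_le ej oj x0 x1 dp) _.
by rewrite le_eqVlt; apply/orP; left; apply/eqP; ring.
Qed.
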